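(* Let $\Sigma\subset\mathbb{R}^3$ be a translating graph (with respect to the Euclidean metric). If $\Sigma$ is $L$-stable, then $\Sigma$ is a stable minimal hypersurface in $\mathbb{R}^3$ with respect to the conformal metric $g_{ij}=e^{x_3}\delta_{ij}$.
   Context: Let $e_3=(0,0,1)$ and let $x_3$ denote the third coordinate. A surface $\Sigma\subset\mathbb{R}^3$ with unit normal $\upsilon$ has mean curvature $H=\operatorname{div}_\Sigma\upsilon$ (so that the first variation of the area element under a normal variation $\eta\upsilon$ is $\eta H\,d\mu$). With the paper's normalization of the speed to $C=-1$, a translating surface is a smooth surface satisfying $H+\langle e_3,\upsilon\rangle=0$. A translating graph is a translating surface that is the graph $\{(x,u(x)):x\in\Omega\}$ of a smooth function $u:\Omega\to\mathbb{R}$ over a domain $\Omega\subset\mathbb{R}^2$. On $\Sigma$ (with the metric induced from the Euclidean metric), $\Delta$ and $\nabla$ are the Laplacian and gradient, $A$ is the second fundamental form, $d\mu$ the area measure, and $$L\eta=\Delta\eta+|A|^2\eta+\langle e_3,\nabla\eta\rangle.$$ A translating surface $\Sigma$ is $L$-stable if $\int_\Sigma\eta\,L\eta\,e^{x_3}\,d\mu\leq 0$ for every smooth compactly supported function $\eta$ on $\Sigma$. A surface is a stable minimal hypersurface in the Riemannian manifold $(\mathbb{R}^3,g)$ if, for every compactly supported normal variation, the first derivative of the $g$-area at $s=0$ vanishes and the second derivative of the $g$-area at $s=0$ is nonnegative. *)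

(* Defs.v *)
From HB Require Import structures.
From mathcomp Require Import all_boot all_order all_algebra.
From mathcomp Require Import all_classical all_reals all_analysis.

Set Implicit Arguments.
Unset Strict Implicit.
Unset Printing Implicit Defensive.

Import Order.TTheory GRing.Theory Num.Theory.
Import numFieldNormedType.Exports.

Local Open Scope classical_set_scope.
Local Open Scope ring_scope.

(* A surface is given by a chart [X : R * R -> 'rV[R]_3]
    on an open set [Omega] of the plane (for a graph, [X (x, y) = (x, y, u (x, y))]),
    and a function on the surface is written in this chart, as a function on
    [Omega].  All functions are total; only their values on [Omega] matter. *)

Section Smooth.
Context {R : realType} {V W : normedModType R}.

(* [f] is of class C^(k+1) on the open set [U] iff it is differentiable at the
   points of [U] and all its directional derivatives are of class C^k on [U]. *)
Fixpoint Ck_on (k : nat) (U : set V) (f : V -> W) : Prop :=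
  if k is k'.+1 then
    (forall x, U x -> differentiable f x) /\ (forall v, Ck_on k' U ('D_v f))
  else forall x, U x -> {for x, continuous f}.

Definition smooth_on (U : set V) (f : V -> W) : Prop := forall k, Ck_on k U f.

End Smooth.

Section Geometry.
Context {R : realType}.
Local Notation R2 := (R * R)%type.
Local Notation E3 := 'rV[R]_3.

Definition vec3 (a b c : R) : E3 := \row_(k < 3) [:: a; b; c]`_k.
Definition e3 : E3 := vec3 0 0 1.
Definition x3 (p : E3) : R := p 0 2.

Definition dot (v w : E3) : R := (v *m w^T) 0 0.

Definition cross (v w : E3) : E3 :=
  vec3 (v 0 1 * w 0 2 - v 0 2 * w 0 1)
       (v 0 2 * w 0 0 - v 0 0 * w 0 2)
       (v 0 0 * w 0 1 - v 0 1 * w 0 0).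

Definition dir (i : 'I_2) : R2 := if i == 0 then (1, 0) else (0, 1).
Definition pd {W : normedModType R} (i : 'I_2) (f : R2 -> W) : R2 -> W :=
  'D_(dir i) f.

Definition mu2 :
    {measure set (measurableTypeR R * measurableTypeR R) -> \bar R} :=
  (@lebesgue_measure R \x @lebesgue_measure R)%E.

(* Riemannian metrics on R^3, given by their Gram matrices. *)
Definition metric := E3 -> 'M[R]_3.

Definition inner (g : metric) (q v w : E3) : R := (v *m g q *m w^T) 0 0.

Definition euclidean : metric := fun _ => 1%:M.

Definition conformal_metric : metric := fun q => (expR (x3 q))%:M.

Definition induced (g : metric) (X : R2 -> E3) (p : R2) : 'M[R]_2 :=
  \matrix_(i, j) inner g (X p) (pd i X p) (pd j X p).

Definition area_density (g : metric) (X : R2 -> E3) (p : R2) : R :=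
  Num.sqrt (\det (induced g X p)).

(* The g-area of the part [X @` K] of the surface.  It is only used for [K]
   compact, so that the integral is finite. *)
Definition area (g : metric) (X : R2 -> E3) (K : set R2) : R :=
  Rintegral mu2 K (area_density g X).

(* First fundamental form; [sff] below is the second one. *)
Definition fff (X : R2 -> E3) : R2 -> 'M[R]_2 := induced euclidean X.
Definition fff_inv (X : R2 -> E3) (p : R2) : 'M[R]_2 := invmx (fff X p).

Definition unit_normal (X : R2 -> E3) (p : R2) : E3 :=
  let n := cross (pd 0 X p) (pd 1 X p) in (Num.sqrt (dot n n))^-1 *: n.

Definition surf_div (X Y : R2 -> E3) (p : R2) : R :=
  \sum_(i < 2) \sum_(j < 2) fff_inv X p i j * dot (pd i Y p) (pd j X p).

Definition mean_curvature (X : R2 -> E3) : R2 -> R :=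
  surf_div X (unit_normal X).

Definition sff (X : R2 -> E3) (p : R2) : 'M[R]_2 :=
  \matrix_(i, j) dot (pd i (unit_normal X) p) (pd j X p).

Definition sqnorm_sff (X : R2 -> E3) (p : R2) : R :=
  \sum_(i < 2) \sum_(j < 2) \sum_(k < 2) \sum_(l < 2)
    fff_inv X p i k * fff_inv X p j l * sff X p i j * sff X p k l.

Definition surf_grad (X : R2 -> E3) (eta : R2 -> R) (p : R2) : E3 :=
  \sum_(i < 2) \sum_(j < 2) (fff_inv X p i j * pd j eta p) *: pd i X p.

(* The Laplace-Beltrami operator in local coordinates: the sum over [i, j] of
   [sqrt(det g)^-1 * d_i (sqrt(det g) * g^{ij} * d_j eta)]. *)
Definition surf_laplacian (X : R2 -> E3) (eta : R2 -> R) (p : R2) : R :=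
  (area_density euclidean X p)^-1 *
  \sum_(i < 2) pd i (fun q => \sum_(j < 2)
    area_density euclidean X q * fff_inv X q i j * pd j eta q) p.

Definition Lop (X : R2 -> E3) (eta : R2 -> R) (p : R2) : R :=
  surf_laplacian X eta p + sqnorm_sff X p * eta p + dot e3 (surf_grad X eta p).

Definition plane_domain (Omega : set R2) : Prop :=
  [/\ Omega !=set0, open Omega & connected Omega].

Definition graph_chart (u : R2 -> R) (p : R2) : E3 := vec3 p.1 p.2 (u p).

(* The condition does not depend on the choice of the unit normal. *)
Definition translating (Omega : set R2) (X : R2 -> E3) : Prop :=
  forall p, Omega p -> mean_curvature X p + dot e3 (unit_normal X p) = 0.

Definition translating_graph (Omega : set R2) (u : R2 -> R) : Prop :=
  [/\ plane_domain Omega, smooth_on Omega u & translating Omega (graph_chart u)].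

Definition test_function (Omega : set R2) (eta : R2 -> R) : Prop :=
  smooth_on Omega eta /\
  exists K : set R2, [/\ compact K, K `<=` Omega &
    forall p, Omega p -> ~ K p -> eta p = 0].

(* The integrand is continuous with compact support in [Omega]. *)
Definition L_stable (Omega : set R2) (X : R2 -> E3) : Prop :=
  forall eta : R2 -> R, test_function Omega eta ->
    Rintegral mu2 Omega (fun p =>
      eta p * Lop X eta p * expR (x3 (X p)) * area_density euclidean X p) <= 0.

(* Any smooth family [F s], [- eps < s < eps], which starts at the surface,
   fixes it outside of the compact set [K] and has a g-normal initial
   velocity; it need not be of the form [X + s *: V]. *)
Definition normal_variation (g : metric) (Omega : set R2) (X : R2 -> E3)
    (eps : R) (K : set R2) (F : R -> R2 -> E3) : Prop :=
  [/\ 0 < eps,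
      compact K /\ K `<=` Omega,
      smooth_on ([set s : R | `|s| < eps] `*` Omega) (fun q => F q.1 q.2),
      (forall p, Omega p -> F 0 p = X p) /\
      (forall s p, `|s| < eps -> Omega p -> ~ K p -> F s p = X p) &
      forall p i, Omega p ->
        inner g (X p) ('D_1 (fun s : R => F s p) 0) (pd i X p) = 0].

(* Outside of [K] the variation is constant, so only the area over [K], which
   is finite, has to be differentiated. *)
Definition stable_minimal (g : metric) (Omega : set R2) (X : R2 -> E3) : Prop :=
  forall (eps : R) (K : set R2) (F : R -> R2 -> E3),
    normal_variation g Omega X eps K F ->
    let a : R -> R := fun s => area g (F s) K in
    [/\ \forall s \near (0 : R), derivable a s 1,
        derivable a^`()%classic 0 1,
        a^`()%classic 0 = 0 &
        0 <= a^`(2)%classic 0].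

End Geometry.

(* Main.v *)
Require Import Defs.
From mathcomp Require Import all_boot all_order all_algebra.
From mathcomp Require Import all_classical all_reals all_analysis.
From mathcomp Require Import ring lra.

(** A translating graph is calibrated, and a calibrated surface minimizes area
among the nearby surfaces with the same boundary; this gives both the vanishing
of the first derivative and the sign of the second one, for every variation.

Let [N] be the unit normal of the graph of [u], extended to the cylinder over
[Omega] so as not to depend on the height, and let [Y = exp z * N]. The mean
curvature of the graph is the divergence of this extension of [N]
([mean_curvature_graph]), so that the divergence of [Y] is
[exp z * (H + dot e3 N)], which is zero by the translator equation
([translating_divergence]).

Let [F] be a variation supported above the compact set [K]. For small [s] the
surface [F s] stays in the cylinder ([tube]), and the flux of [Y] across it has
two properties. It is at most the area of [F s] for the metric [exp z] times the
Euclidean one, because this metric multiplies areas by [exp z], the Euclidean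
length of [Y] ([var_flux_le]); and there is equality at [s = 0], where [Y] is
normal to the surface ([var_flux0]). Moreover the flux does not depend on [s]:
since [Y] has no divergence, the derivative in [s] of the pulled-back flux form is
a divergence in the parameters of the surface ([derive_flux], an identity between
determinants together with the symmetry of second derivatives), and it is the
divergence of a field with compact support, whose integral vanishes
([Rintegral_pd_compact_support], [Rintegral_derive_var_flux]).

So the difference of the area and the flux has a minimum at [s = 0] and the same
derivatives as the area. The area is twice differentiable by differentiation
under the integral sign ([is_derive_under_integral]), and the conclusion is the
second derivative test ([derive2_min]). *)

Set Implicit Arguments.
Unset Strict Implicit.
Unset Printing Implicit Defensive.

Import Order.TTheory GRing.Theory Num.Theory.
Import numFieldNormedType.Exports.

Local Open Scope classical_set_scope.
Local Open Scope ring_scope.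

(** * Functions of class C^k *)

Section NearEq.
Context {R : realType} {V W : normedModType R}.

(** Differentiability at a point only sees the germ of the function: the two
expansions at [x] share their first-order part. *)
Lemma near_eq_differentiable (f g : V -> W) (x : V) :
  (\forall y \near x, f y = g y) -> differentiable f x -> differentiable g x.
Proof.
move=> fg df; have [dfc dfo] := (diff_locallyP _ _).1 df.
have fgx : f x = g x := nbhs_singleton fg.
have gE : g \o shift x = cst (g x) + 'd f x +o_ 0 id.
  apply/eqaddoP => _/posnumP[e].
  have /eqaddoP /(_ e%:num ltac:(by [])) := dfo.
  have : \forall h \near (0 : V), f (h + x) = g (h + x).
    by move: fg; rewrite (near_shift 0 x); apply: filterS => h /=; rewrite subr0.
  by apply: filterS2 => h /= fgh; rewrite -!fgx /= !fctE/= -fgh.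
apply/diff_locallyP.
have -> : 'd g x = 'd f x :> (V -> W) by exact: diff_unique.
by split.
Qed.

Lemma open_near_eq (U : set V) (f g : V -> W) (x : V) : open U ->
  (forall y, U y -> f y = g y) -> U x -> \forall y \near x, f y = g y.
Proof. by move=> oU fg Ux; apply: filterS (open_nbhs_nbhs (conj oU Ux)). Qed.

End NearEq.

Section CkOn.
Context {R : realType} {V : normedModType R}.

Lemma Ck_on_eq {W : normedModType R} k (U : set V) (f g : V -> W) : open U ->
  (forall y, U y -> f y = g y) -> Ck_on k U f -> Ck_on k U g.
Proof.
move=> oU; elim: k f g => [|k IH] f g fg /=.
  move=> cf x Ux; rewrite /prop_for /continuous_at -(fg x Ux).
  apply: cvg_trans (cf x Ux); apply: near_eq_cvg.
  exact: open_near_eq fg Ux.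
move=> [df cDf]; split=> [x Ux|v].
  exact: near_eq_differentiable (open_near_eq oU fg Ux) (df x Ux).
apply: IH (cDf v) => x Ux.
exact/near_eq_derive/(open_near_eq oU fg Ux).
Qed.

Lemma Ck_onS {W : normedModType R} k (U : set V) (f : V -> W) :
  Ck_on k.+1 U f -> Ck_on k U f.
Proof.
elim: k f => [|k IH] f [df cDf].
  by move=> x Ux; exact/differentiable_continuous/df.
by split=> // v; exact/IH/cDf.
Qed.

Lemma Ck_on_subset {W : normedModType R} k (U U' : set V) (f : V -> W) :
  U' `<=` U -> Ck_on k U f -> Ck_on k U' f.
Proof.
move=> UU'; elim: k f => [|k IH] f /=; first by move=> cf x /UU'; exact: cf.
by move=> [df cDf]; split=> [x /UU'|v]; [exact: df|exact/IH/cDf].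
Qed.

Lemma Ck_on_cst {W : normedModType R} k (U : set V) (c : W) : Ck_on k U (cst c).
Proof.
elim: k c => [|k IH] c /=; first by move=> x _; exact: cst_continuous.
split=> [x _|v]; first exact: differentiable_cst.
rewrite (_ : 'D_v (cst c) = cst 0) //.
by apply/funext => x; rewrite derive_cst.
Qed.

Lemma Ck_onD {W : normedModType R} k (U : set V) (f g : V -> W) : open U ->
  Ck_on k U f -> Ck_on k U g -> Ck_on k U (f + g).
Proof.
move=> oU; elim: k f g => [|k IH] f g.
  by move=> cf cg x Ux; apply: cvgD; [exact: cf|exact: cg].
move=> [df cDf] [dg cDg]; split=> [x Ux|v].
  by apply: differentiableD; [exact: df|exact: dg].
apply: (@Ck_on_eq _ _ _ ('D_v f + 'D_v g)) => //; last first.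
  by apply: IH; [exact: cDf|exact: cDg].
by move=> x Ux; rewrite deriveD//; apply: diff_derivable; [exact: df|exact: dg].
Qed.

Lemma Ck_onM k (U : set V) (f g : V -> R) : open U ->
  Ck_on k U f -> Ck_on k U g -> Ck_on k U (f * g).
Proof.
move=> oU; elim: k f g => [|k IH] f g.
  by move=> cf cg x Ux; apply: cvgM; [exact: cf|exact: cg].
move=> cf cg; have [df cDf] := cf; have [dg cDg] := cg; split=> [x Ux|v].
  by apply: differentiableM; [exact: df|exact: dg].
apply: (@Ck_on_eq _ _ _ (f * 'D_v g + g * 'D_v f)) => //.
  move=> x Ux.
  by rewrite deriveM//; apply: diff_derivable; [exact: df|exact: dg].
by apply: Ck_onD => //; apply: IH; do ?[exact: Ck_onS|exact: cDf|exact: cDg].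
Qed.

Lemma is_derive_comp1 (g : R -> R) (f : V -> R) (x v : V) (dg df : R) :
  is_derive (f x) 1 g dg -> differentiable f x -> is_derive x v f df ->
  is_derive x v (g \o f) (dg * df).
Proof.
move=> [dg1 dgE] df' [_ dfE].
have dg2 : differentiable g (f x) by exact/derivable1_diffP.
have dgf : differentiable (g \o f) x by exact: differentiable_comp.
apply: DeriveDef; first exact: diff_derivable.
rewrite deriveE// diff_comp//= -(deriveE v df') dfE.
by rewrite deriv1E// derive1E dgE mulrC.
Qed.

(** Induction on [k] from the chain rule ['D_v (g \o f) = (g' \o f) * 'D_v f]. In the
hypothesis on [g'], the regularity of [g \o f] one order below is available: for
the exponential, the inverse and the square root, [g'] is an algebraic function
of [g], so that nothing else has to be known. *)
Lemma Ck_on_comp1 (g g' : R -> R) (P : set R) k (U : set V) (f : V -> R) :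
  open U -> (forall x, U x -> P (f x)) ->
  (forall y, P y -> is_derive y 1 g (g' y)) ->
  (forall k' , (k' < k)%N -> Ck_on k' U f -> Ck_on k' U (g \o f) ->
     Ck_on k' U (g' \o f)) ->
  Ck_on k U f -> Ck_on k U (g \o f).
Proof.
move=> oU UP gg'; elim: k => [|k IH] Hg' cf.
  move=> x Ux; apply: continuous_comp; first exact: cf.
  by apply/differentiable_continuous/derivable1_diffP; have [] := gg' _ (UP _ Ux).
have {}IH : Ck_on k U (g \o f).
  apply: IH; last exact: Ck_onS.
  by move=> k' kk'; apply: Hg'; exact: ltnW.
have cf' := Ck_onS cf.
have [df cDf] := cf; split=> [x Ux|v].
  apply: differentiable_comp; first exact: df.
  by apply/derivable1_diffP; have [] := gg' _ (UP _ Ux).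
apply: (@Ck_on_eq _ _ _ ((g' \o f) * 'D_v f)) => //.
  move=> x Ux; apply/esym; apply: derive_val.
  apply: is_derive_comp1; [exact/gg'/UP|exact: df|].
  by apply/derivableP/diff_derivable/df.
by apply: Ck_onM => //; [exact: Hg'|exact: cDf].
Qed.

Lemma Ck_on_expR k (U : set V) (f : V -> R) : open U ->
  Ck_on k U f -> Ck_on k U (expR \o f).
Proof.
by move=> oU; apply: (@Ck_on_comp1 _ expR setT).
Qed.

Lemma Ck_on_inv k (U : set V) (f : V -> R) : open U ->
  (forall x, U x -> f x != 0) -> Ck_on k U f -> Ck_on k U (fun x => (f x)^-1).
Proof.
move=> oU f0; apply: (@Ck_on_comp1 _ (fun y => - (y^-1 * y^-1)) [set y | y != 0]) => //.
  move=> y /= y0; apply: DeriveDef.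
    by apply: (@derivableV _ _ id).
  by rewrite (@deriveV _ _ id)// derive_id scaler1 expr2 invfM.
move=> k' _ _ cV.
have -> : (fun y => - (y^-1 * y^-1)) \o f =
   cst (-1) * ((fun x => (f x)^-1) * (fun x => (f x)^-1)).
  by apply/funext => x /=; rewrite !fctE/= mulN1r.
by apply: Ck_onM => //; [exact: Ck_on_cst|exact: Ck_onM].
Qed.

Lemma Ck_on_sqrt k (U : set V) (f : V -> R) : open U ->
  (forall x, U x -> 0 < f x) -> Ck_on k U f ->
  Ck_on k U (fun x => Num.sqrt (f x)).
Proof.
move=> oU f0.
apply: (@Ck_on_comp1 Num.sqrt (fun y => (2 * Num.sqrt y)^-1) [set y | 0 < y]) => //.
move=> k' _ _ cS; apply: Ck_on_inv => //.
  by move=> x Ux; rewrite mulf_neq0// sqrtr_eq0 -ltNge f0.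
have -> : (fun x => 2 * Num.sqrt (f x)) = cst 2 * (fun x => Num.sqrt (f x)).
  by [].
by apply: Ck_onM => //; exact: Ck_on_cst.
Qed.

(** Chain rule through the plane: the vector [('D_v a x, 'D_v b x)] is expanded in
the canonical basis, which makes the partial derivatives of [g] appear. *)
Lemma is_derive_comp2 (g : R * R -> R) (a b : V -> R) (x v : V) :
  differentiable a x -> differentiable b x -> differentiable g (a x, b x) ->
  is_derive x v (fun y => g (a y, b y))
    ('D_v a x * pd 0 g (a x, b x) + 'D_v b x * pd 1 g (a x, b x)).
Proof.
move=> da db dg.
have dab : differentiable (fun y => (a y, b y)) x by exact: differentiable_pair.
have dgab : differentiable (g \o (fun y => (a y, b y))) x.
  exact: differentiable_comp.
apply: DeriveDef; first exact: diff_derivable.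
rewrite [LHS]deriveE// diff_comp//= diff_pair// /pd /dir/= !deriveE//.
set l := 'd g _.
have -> : ('d a x v, 'd b x v) =
    'd a x v *: ((1, 0) : R * R) + 'd b x v *: ((0, 1) : R * R).
  apply: injective_projections => /=.
    by rewrite scaler0 addr0 [_%:A]mulr1.
  by rewrite scaler0 add0r [_%:A]mulr1.
by rewrite linearD !linearZ.
Qed.

Lemma Ck_on_comp2 k (U : set V) (U' : set (R * R)) (g : R * R -> R)
    (a b : V -> R) : open U -> (forall x, U x -> U' (a x, b x)) ->
  Ck_on k U a -> Ck_on k U b -> Ck_on k U' g ->
  Ck_on k U (fun x => g (a x, b x)).
Proof.
move=> oU abU; elim: k g => [|k IH] g ca cb cg.
  move=> x Ux; apply: (@continuous_comp _ _ _ (fun y => (a y, b y)) g).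
    exact: (cvg_pair (ca x Ux) (cb x Ux)).
  by apply: cg; exact: abU.
have [da cDa] := ca; have [db cDb] := cb; have [dg cDg] := cg.
split=> [x Ux|v].
  apply: (@differentiable_comp _ _ _ _ (fun y => (a y, b y)) g).
    by apply: differentiable_pair; [exact: da|exact: db].
  by apply: dg; exact: abU.
apply: (@Ck_on_eq _ _ _ (('D_v a) * (fun x => pd 0 g (a x, b x)) +
                        ('D_v b) * (fun x => pd 1 g (a x, b x)))) => //.
  move=> x Ux; apply/esym; apply: derive_val; apply: is_derive_comp2.
  - exact: da.
  - exact: db.
  - by apply: dg; exact: abU.
by apply: Ck_onD => //; apply: Ck_onM => //;
  [exact: cDa|apply: IH|exact: cDb|apply: IH];
  by [exact: Ck_onS|exact: cDg].
Qed.

End CkOn.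

Section SmoothOn.
Context {R : realType} {V : normedModType R}.
Implicit Types (U : set V) (f g : V -> R).

Lemma smooth_on_eq {W : normedModType R} U (f g : V -> W) : open U ->
  (forall y, U y -> f y = g y) -> smooth_on U f -> smooth_on U g.
Proof. by move=> oU fg sf k; exact: Ck_on_eq (sf k). Qed.

Lemma smooth_on_subset {W : normedModType R} U U' (f : V -> W) :
  U' `<=` U -> smooth_on U f -> smooth_on U' f.
Proof. by move=> UU' sf k; exact: Ck_on_subset (sf k). Qed.

Lemma smooth_on_derive {W : normedModType R} U (f : V -> W) v :
  smooth_on U f -> smooth_on U ('D_v f).
Proof. by move=> sf k; have [_ cDf] := sf k.+1; exact: cDf. Qed.

Lemma smooth_on_differentiable {W : normedModType R} U (f : V -> W) x :
  smooth_on U f -> U x -> differentiable f x.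
Proof. by move=> sf Ux; have [df _] := sf 1%N; exact: df. Qed.

Lemma smooth_on_continuous {W : normedModType R} U (f : V -> W) x :
  smooth_on U f -> U x -> {for x, continuous f}.
Proof. by move=> sf Ux; exact: (sf 0%N). Qed.

Lemma smooth_on_is_derive {W : normedModType R} U (f : V -> W) x v :
  smooth_on U f -> U x -> is_derive x v f ('D_v f x).
Proof.
by move=> sf Ux; apply/derivableP/diff_derivable/(smooth_on_differentiable sf).
Qed.

Lemma smooth_on_cst {W : normedModType R} U (c : W) : smooth_on U (cst c).
Proof. by move=> k; exact: Ck_on_cst. Qed.

Lemma smooth_onD U f g : open U ->
  smooth_on U f -> smooth_on U g -> smooth_on U (f + g).
Proof. by move=> oU sf sg k; exact: Ck_onD. Qed.

Lemma smooth_onM U f g : open U ->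
  smooth_on U f -> smooth_on U g -> smooth_on U (f * g).
Proof. by move=> oU sf sg k; exact: Ck_onM. Qed.

Lemma smooth_onN U f : open U -> smooth_on U f -> smooth_on U (- f).
Proof.
move=> oU sf; have -> : - f = cst (-1) * f.
  by apply/funext => x; rewrite !fctE mulN1r.
by apply: smooth_onM => //; exact: smooth_on_cst.
Qed.

Lemma smooth_onB U f g : open U ->
  smooth_on U f -> smooth_on U g -> smooth_on U (f - g).
Proof. by move=> oU sf sg; apply: smooth_onD => //; exact: smooth_onN. Qed.

Lemma smooth_on_expR U f : open U -> smooth_on U f -> smooth_on U (expR \o f).
Proof. by move=> oU sf k; exact: Ck_on_expR. Qed.

Lemma smooth_on_inv U f : open U -> (forall x, U x -> f x != 0) ->
  smooth_on U f -> smooth_on U (fun x => (f x)^-1).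
Proof. by move=> oU f0 sf k; exact: Ck_on_inv. Qed.

Lemma smooth_on_sqrt U f : open U -> (forall x, U x -> 0 < f x) ->
  smooth_on U f -> smooth_on U (fun x => Num.sqrt (f x)).
Proof. by move=> oU f0 sf k; exact: Ck_on_sqrt. Qed.

Lemma smooth_on_comp2 U (U' : set (R * R)) (h : R * R -> R) f g : open U ->
  (forall x, U x -> U' (f x, g x)) ->
  smooth_on U f -> smooth_on U g -> smooth_on U' h ->
  smooth_on U (fun x => h (f x, g x)).
Proof. by move=> oU fgU sf sg sh k; exact: Ck_on_comp2 fgU _ _ (sh k). Qed.

End SmoothOn.

(** * Symmetry of second derivatives *)

Section Schwarz.
Context {R : realType} {V : normedModType R}.
Implicit Types (U : set V) (f : V -> R).

(** The restriction of [f] to a line is differentiated with the difference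
quotients of ['D_v f] themselves. *)
Lemma is_derive_line {W : normedModType R} (f : V -> W) (x v : V) (t : R) df :
  is_derive (t *: v + x) v f df ->
  is_derive t 1 (fun s : R => f (s *: v + x)) df.
Proof.
move=> [fd fE].
have lineE : (fun h : R => h^-1 *:
      (((fun s : R => f (s *: v + x)) \o shift t) (h *: 1) - f (t *: v + x))) =
    (fun h => h^-1 *: ((f \o shift (t *: v + x)) (h *: v) - f (t *: v + x))).
  by apply/funext => h /=; rewrite scalerDl [h *: 1]mulr1 addrA.
by apply: DeriveDef; rewrite /derivable/derive lineE.
Qed.

(** Two applications of the mean value theorem, first along [v] and then along
[w], to the second difference of [f] on the parallelogram of sides [h *: v] and
[h *: w]. *)
Lemma second_difference U f (v w x : V) (h : R) : open U -> Ck_on 2 U f ->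
  0 < h ->
  (forall s t, 0 <= s <= h -> 0 <= t <= h -> U (s *: v + (t *: w + x))) ->
  exists s t, [/\ 0 <= s <= h, 0 <= t <= h &
    f (h *: v + (h *: w + x)) - f (h *: v + x) - (f (h *: w + x) - f x) =
    'D_w ('D_v f) (s *: v + (t *: w + x)) * (h * h)].
Proof.
move=> oU [df cDf] h0 Uh; have [dDf _] := cDf v.
have h00 : 0 <= (0 : R) <= h by rewrite lexx ltW.
have hh : 0 <= h <= h by rewrite lexx ltW.
have Uh0 s : 0 <= s <= h -> U (s *: v + x).
  by move=> sh; have := Uh s 0 sh h00; rewrite scale0r add0r.
pose phi s := f (s *: v + (h *: w + x)) - f (s *: v + x).
have dphi s : 0 <= s <= h -> is_derive s 1 phi
    ('D_v f (s *: v + (h *: w + x)) - 'D_v f (s *: v + x)).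
  move=> sh.
  have d1 : is_derive s 1 (fun s => f (s *: v + (h *: w + x)))
      ('D_v f (s *: v + (h *: w + x))).
    by apply: is_derive_line; apply/derivableP/diff_derivable/df/Uh.
  have d2 : is_derive s 1 (fun s => f (s *: v + x)) ('D_v f (s *: v + x)).
    by apply: is_derive_line; apply/derivableP/diff_derivable/df/Uh0.
  exact: is_deriveB.
have [s /[!in_itv]/= /andP[s0 sh] phiE] :
    exists2 c, c \in `]0, h[%R & phi h - phi 0 =
      ('D_v f (c *: v + (h *: w + x)) - 'D_v f (c *: v + x)) * (h - 0).
  apply: (@MVT _ phi (fun s => 'D_v f (s *: v + (h *: w + x)) -
                             'D_v f (s *: v + x)) 0 h h0).
    by move=> s; rewrite in_itv/= => /andP[? ?]; apply: dphi; rewrite !ltW.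
  apply: derivable_within_continuous => s; rewrite in_itv/= => sh.
  by have [] := dphi s sh.
have {s0 sh} sh : 0 <= s <= h by rewrite !ltW.
pose psi t := 'D_v f (t *: w + (s *: v + x)).
have swap t : t *: w + (s *: v + x) = s *: v + (t *: w + x).
  by rewrite addrCA.
have dpsi t : 0 <= t <= h ->
    is_derive t 1 psi ('D_w ('D_v f) (t *: w + (s *: v + x))).
  move=> th; apply: (@is_derive_line _ ('D_v f)).
  have dd : differentiable ('D_v f) (t *: w + (s *: v + x)).
    by apply: dDf; rewrite swap; exact: Uh.
  exact/derivableP/diff_derivable.
have [t /[!in_itv]/= /andP[t0 th] psiE] :
    exists2 c, c \in `]0, h[%R & psi h - psi 0 =
      'D_w ('D_v f) (c *: w + (s *: v + x)) * (h - 0).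
  apply: (@MVT _ psi (fun t => 'D_w ('D_v f) (t *: w + (s *: v + x))) 0 h h0).
    by move=> t; rewrite in_itv/= => /andP[? ?]; apply: dpsi; rewrite !ltW.
  apply: derivable_within_continuous => t; rewrite in_itv/= => th.
  by have [] := dpsi t th.
have {t0 th} th : 0 <= t <= h by rewrite !ltW.
exists s, t; split => //.
move: phiE psiE; rewrite /phi /psi !swap !scale0r !add0r !subr0 => -> ->.
by rewrite mulrA.
Qed.

(** Schwarz's theorem: the second difference is symmetric in [v] and [w], so it
equals [h * h] times either mixed derivative, each taken at some point of the
parallelogram; both derivatives are continuous, and [h] is arbitrarily small. *)
Lemma derive_comm U f (v w x : V) : open U -> Ck_on 2 U f -> U x ->
  'D_w ('D_v f) x = 'D_v ('D_w f) x.
Proof.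
move=> oU cf Ux; apply/eqP; rewrite -subr_eq0 -normr_le0.
apply/ler_addgt0Pr => e e0; rewrite add0r; have e20 : 0 < e / 2 by rewrite divr_gt0.
have close (a b c : R) : `|a - c| < e / 2 -> `|b - c| < e / 2 -> `|a - b| <= e.
  move=> ac bc; rewrite (le_trans (ler_distD c _ _))//.
  by rewrite [leRHS]splitr lerD ?ltW// distrC.
have [_ cDf] := cf; have [_ cDvf] := cDf v; have [_ cDwf] := cDf w.
have cvw := cDvf w x Ux; have cwv := cDwf v x Ux.
have : \forall y \near x, [/\ U y,
    `|'D_w ('D_v f) x - 'D_w ('D_v f) y| < e / 2 &
    `|'D_v ('D_w f) x - 'D_v ('D_w f) y| < e / 2].
  have /cvgrPdist_lt/(_ _ e20) nvw := cvw.
  have /cvgrPdist_lt/(_ _ e20) nwv := cwv.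
  have nU : \forall y \near x, U y by exact: open_nbhs_nbhs.
  by apply: filterS3 nU nvw nwv => y Uy yvw ywv; exact: (And3 Uy yvw ywv).
move=> /nbhs_ballP[r /= r0 rP].
(* With this size the parallelogram based at [x] stays in the ball of radius [r]. *)
pose h := r / 2 / (`|v| + `|w| + 1).
have vw0 : 0 < `|v| + `|w| + 1 by rewrite ltr_wpDl// addr_ge0.
have h0 : 0 < h by rewrite !divr_gt0.
have hr s t : 0 <= s <= h -> 0 <= t <= h -> ball x r (s *: v + (t *: w + x)).
  move=> /andP[s0 sh] /andP[t0 th].
  rewrite -ball_normE/= addrA distrC addrK.
  rewrite (le_lt_trans (ler_normD _ _))// !normrZ (ger0_norm s0) (ger0_norm t0).
  apply: (@le_lt_trans _ _ (h * (`|v| + `|w| + 1))).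
    by rewrite 2!mulrDr -[leLHS]addr0 lerD ?mulr1 ?(ltW h0)// lerD// ler_wpM2r.
  by rewrite /h divfK ?gt_eqF// gtr_pMr// invf_lt1// ltr1n.
have [s [t [sh th E1]]] := second_difference oU cf h0
  (fun s t sh th => let: And3 Us _ _ := rP _ (hr s t sh th) in Us).
have hr' t' s' : 0 <= t' <= h -> 0 <= s' <= h -> U (t' *: w + (s' *: v + x)).
  by move=> t'h s'h; rewrite addrCA; have [] := rP _ (hr _ _ s'h t'h).
have [t' [s' [th' sh' E2]]] := second_difference oU cf h0 hr'.
have hh0 : h * h != 0 by rewrite mulf_neq0// gt_eqF.
rewrite [t' *: w + (s' *: v + x)]addrCA in E2.
have E12 : f (h *: v + (h *: w + x)) - f (h *: v + x) - (f (h *: w + x) - f x) =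
           f (h *: w + (h *: v + x)) - f (h *: w + x) - (f (h *: v + x) - f x).
  rewrite (addrCA (h *: w)).
  move: (f _) (f _) (f _) (f _) => A1 A2 A3 A4.
  by rewrite !opprB addrACA [in RHS]addrACA; congr (_ + _); rewrite addrC.
have E := mulIf hh0 (etrans (esym E1) (etrans E12 E2)).
have [_ H1 _] := rP _ (hr _ _ sh th); have [_ _ H2] := rP _ (hr _ _ sh' th').
rewrite E in H1; exact: close H1 H2.
Qed.

End Schwarz.

(** * Measure and integrals on compact subsets of the plane *)

Section PlaneMeasure.
Context {R : realType}.
Local Notation R2 := (R * R)%type.
Local Notation M2 := (measurableTypeR R * measurableTypeR R)%type.

(** The product sigma-algebra is Borel because rational boxes form a countable
basis of the plane. *)
Lemma open_measurable2 (U : set R2) : open U -> measurable (U : set M2).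
Proof.
move=> oU.
pose box (a b c d : rat) : set M2 :=
  `]ratr a : R, ratr b[%classic `*` `]ratr c : R, ratr d[%classic.
pose B a b c d : set M2 := if `[< box a b c d `<=` U >] then box a b c d else set0.
have -> : U = \bigcup_(a in [set: rat]) \bigcup_(b in [set: rat])
    \bigcup_(c in [set: rat]) \bigcup_(d in [set: rat]) B a b c d.
  apply/seteqP; split => [[x y] Uxy|]; last first.
    move=> p [a _ [b _ [c _ [d _]]]]; rewrite /B.
    by case: ifPn => // /asboolP; apply.
  have /nbhs_ballP[r /= r0 rU] := open_nbhs_nbhs (conj oU Uxy).
  have [a] := @rat_in_itvoo R (x - r) x ltac:(by rewrite gtrBl).
  rewrite in_itv/= => /andP[ra ax].
  have [b] := @rat_in_itvoo R x (x + r) ltac:(by rewrite ltrDl).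
  rewrite in_itv/= => /andP[xb br].
  have [c] := @rat_in_itvoo R (y - r) y ltac:(by rewrite gtrBl).
  rewrite in_itv/= => /andP[rc cy].
  have [d] := @rat_in_itvoo R y (y + r) ltac:(by rewrite ltrDl).
  rewrite in_itv/= => /andP[yd dr].
  exists a => //; exists b => //; exists c => //; exists d => //.
  have boxU : box a b c d `<=` U.
    move=> [s t] [/=]; rewrite !in_itv/= => /andP[as_ sb] /andP[ct td].
    apply: rU; split => /=; rewrite /ball/= ltr_norml; apply/andP; split; lra.
  rewrite /B asboolT//; split => /=; rewrite in_itv/=; first by rewrite ax xb.
  by rewrite cy yd.
do 4 (apply: bigcupT_measurable_rat => ?).
rewrite /B; case: ifPn => // _.
by apply: measurableX; exact: measurable_itv.
Qed.

Lemma closed_measurable2 (A : set R2) : closed A -> measurable (A : set M2).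
Proof.
move=> cA; rewrite -[A]setCK; apply: measurableC.
by apply: open_measurable2; exact: closed_openC.
Qed.

Lemma compact_closed2 (K : set R2) : compact K -> closed K.
Proof. by apply: compact_closed; exact: norm_hausdorff. Qed.

Lemma compact_measurable2 (K : set R2) : compact K -> measurable (K : set M2).
Proof. by move=> cK; apply: closed_measurable2; exact: compact_closed2. Qed.

(** The strict inclusion leaves room for integrating along lines up to points
where a function supported in [K] vanishes. *)
Lemma compact_sub_square (K : set R2) : compact K ->
  exists2 M : R, 0 < M & K `<=` `]- M, M[%classic `*` `]- M, M[%classic.
Proof.
move=> /compact_bounded[N [_ NK]].
exists (`|N| + 2); first by rewrite ltr_wpDl.
move=> [x y] Kxy; have := NK (`|N| + 1) ltac:(by rewrite ltr_pwDr// ler_norm) _ Kxy.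
rewrite /= [`|_|]prod_normE/= ge_max => /andP[].
rewrite !ler_norml => /andP[? ?] /andP[? ?]; split => /=; rewrite in_itv/=;
  apply/andP; split; lra.
Qed.

Lemma compact_finite_measure2 (K : set R2) : compact K -> (mu2 K < +oo)%E.
Proof.
move=> cK; have [M M0 KM] := compact_sub_square cK.
pose I : set (measurableTypeR R) := `]- M, M[%classic.
have mI : measurable I by exact: measurable_itv.
have muI : (mu2 (I `*` I) = lebesgue_measure I * lebesgue_measure I)%E.
  exact: product_measure1E.
apply: (@le_lt_trans _ _ (mu2 (I `*` I))).
  apply: le_measure; rewrite ?inE//; first exact: compact_measurable2.
  exact: measurableX.
rewrite muI /I !lebesgue_measure_itv/=.
by case: ifP => _; rewrite ?mul0e// -EFinM ltry.
Qed.

Lemma continuous_compact_measurable2 (K : set R2) (f : R2 -> R) : compact K ->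
  {within K, continuous f} -> measurable_fun (K : set M2) (f : M2 -> measurableTypeR R).
Proof.
move=> cK /continuousP cf; apply: (measurability _ (measurable_realfun.RGenOpens.measurableE R)).
move=> _ [_ [a [b ->] <-]].
have /open_subspaceP [V oV VD] := cf _ (@interval_open R (BRight a) (BLeft b) isT isT).
rewrite setIC -VD; apply: measurableI; first exact: open_measurable2.
exact: compact_measurable2.
Qed.

Lemma continuous_compact_integrable2 (K : set R2) (f : R2 -> R) : compact K ->
  {within K, continuous f} -> mu2.-integrable K (EFin \o f).
Proof.
move=> cK cf; apply: measurable_bounded_integrable.
- exact: compact_measurable2.
- exact: compact_finite_measure2.
- exact: continuous_compact_measurable2.
- have /compact_bounded[M [_ mrt]] := continuous_compact cf cK.
  by exists M; split; rewrite ?num_real // => ? ? ? ?; exact: mrt.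
Qed.

End PlaneMeasure.

(** * Differentiation under the integral sign *)

Section Slices.
Context {R : realType} {V1 V2 W : normedModType R}.
Implicit Type f : V1 * V2 -> W.

Lemma derive_slice1 f x y v :
  'D_v (fun z => f (z, y)) x = 'D_((v, 0) : V1 * V2) f (x, y).
Proof.
rewrite /derive; set q1 := fun h : R => _; set q2 := fun h : R => _.
suff -> : q1 = q2 by [].
apply/funext => h; rewrite /q1 /q2 /=.
congr (_ *: (f _ - _)); apply: injective_projections => //=.
by rewrite scaler0 add0r.
Qed.

Lemma derive_slice2 f x y v :
  'D_v (fun z => f (x, z)) y = 'D_((0, v) : V1 * V2) f (x, y).
Proof.
rewrite /derive; set q1 := fun h : R => _; set q2 := fun h : R => _.
suff -> : q1 = q2 by [].
apply/funext => h; rewrite /q1 /q2 /=.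
congr (_ *: (f _ - _)); apply: injective_projections => //=.
by rewrite scaler0 add0r.
Qed.

Lemma differentiable_slice1 f x y :
  differentiable f (x, y) -> differentiable (fun z => f (z, y)) x.
Proof.
by move=> df; apply: (@differentiable_comp _ _ _ _ (fun z => (z, y)) f).
Qed.

Lemma differentiable_slice2 f x y :
  differentiable f (x, y) -> differentiable (fun z => f (x, z)) y.
Proof.
by move=> df; apply: (@differentiable_comp _ _ _ _ (fun z => (x, z)) f).
Qed.

Lemma continuous_slice2 f x y :
  {for (x, y), continuous f} -> {for y, continuous (fun z => f (x, z))}.
Proof.
move=> cf; apply: (@continuous_comp _ _ _ (fun z => (x, z)) f) => //.
by apply/differentiable_continuous/differentiable_pair.
Qed.

End Slices.

Section UnderIntegral.
Context {R : realType}.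
Local Notation R2 := (R * R)%type.

Lemma continuous_within {T U : topologicalType} (A : set T) (f : T -> U) :
  (forall x, A x -> {for x, continuous f}) -> {within A, continuous f}.
Proof. by move=> cf; apply: continuous_in_subspaceT => x /[!inE]; exact: cf. Qed.

(** Domination is free here: on [[- r, r] `*` K], with [|s| < r < d], the derivative
of [phi] in [s] is continuous on a compact set, hence bounded, and [K] has
finite measure. *)
Lemma is_derive_under_integral (U K : set R2) (phi : R * R2 -> R) (d s : R) :
  open U -> compact K -> K `<=` U ->
  Ck_on 1 ([set s : R | `|s| < d] `*` U) phi -> `|s| < d ->
  is_derive s 1 (fun s => Rintegral mu2 K (fun p => phi (s, p)))
    (Rintegral mu2 K (fun p => 'D_((1, 0) : R * R2) phi (s, p))).
Proof.
move=> oU cK KU [dphi cDphi] sd.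
pose r := (`|s| + d) / 2.
have [sr rd] : `|s| < r /\ r < d.
  by rewrite /r; split; lra.
have inW t p : - r <= t <= r -> K p -> ([set s : R | `|s| < d] `*` U) (t, p).
  move=> tr Kp; split => /=; last exact: KU.
  by rewrite (le_lt_trans _ rd)// ler_norml.
have [M [_ Mb]] : bounded_set
    ('D_((1, 0) : R * R2) phi @` (`[- r, r]%classic `*` K)).
  apply: compact_bounded; apply: continuous_compact.
    apply: continuous_within => -[t p] [/= ] /[!in_itv]/= tr Kp.
    by apply: cDphi; exact: inW.
  by apply: compact_setX => //; exact: segment_compact.
have Gb t p : - r <= t <= r -> K p ->
    `|'D_((1, 0) : R * R2) phi (t, p)| <= `|M| + 1.
  move=> tr Kp; apply: Mb; first by rewrite ltr_pwDr// ler_norm.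
  by exists (t, p) => //; split => //=; rewrite in_itv.
have sI : (`]- r, r[%classic : set R) s by rewrite /= in_itv/= -ltr_norml.
have itv_le (t : R) : (`]- r, r[%classic : set R) t -> - r <= t <= r.
  by rewrite /= in_itv/= => /andP[? ?]; rewrite !ltW.
have dslice t p : (`]- r, r[%classic : set R) t -> K p ->
    derivable (fun t => phi (t, p)) t 1.
  move=> /itv_le tr Kp; apply: diff_derivable.
  by apply: differentiable_slice1; apply: dphi; exact: inW.
have intphi (t : R) : (`]- r, r[%classic : set R) t ->
    mu2.-integrable K (EFin \o (fun p => phi (t, p))).
  move=> /itv_le tr; apply: continuous_compact_integrable2 => //.
  apply: continuous_within => p Kp; apply: continuous_slice2.
  by apply/differentiable_continuous; apply: dphi; exact: inW.
have d1E t p : partial1of2 (fun t p => phi (t, p)) t p =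
    'D_((1, 0) : R * R2) phi (t, p).
  by rewrite partial1of2E derive_slice1.
have H := @cvg_differentiation_under_integral R _ _ mu2
  (fun t p => phi (t, p)) K (compact_measurable2 cK) s (- r) r sI intphi dslice
  (fun=> `|M| + 1) _ _ _.
have {}H : h^-1 *: ((fun s => Rintegral mu2 K (fun p => phi (s, p))) (h + s) -
     Rintegral mu2 K (fun p => phi (s, p))) @[h --> 0^'] -->
   Rintegral mu2 K (fun p => 'D_((1, 0) : R * R2) phi (s, p)).
  have -> : Rintegral mu2 K (fun p => 'D_((1, 0) : R * R2) phi (s, p)) =
      Rintegral mu2 K (partial1of2 (fun t p => phi (t, p)) s).
    by apply: eq_Rintegral => p _; exact/esym/d1E.
  apply: H => //.
  - apply: continuous_compact_integrable2 => //.
    by apply: continuous_within => p _; exact: cst_continuous.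
  - by move=> t p /itv_le tr Kp; rewrite d1E; exact: Gb.
have HE : (fun h : R => h^-1 *: (((fun s => Rintegral mu2 K (fun p => phi (s, p)))
    \o shift s) (h *: 1) - Rintegral mu2 K (fun p => phi (s, p)))) =
  (fun h : R => h^-1 *: (((fun s => Rintegral mu2 K (fun p => phi (s, p))) (h + s)) -
    Rintegral mu2 K (fun p => phi (s, p)))).
  by apply/funext => h /=; rewrite [h *: 1]mulr1.
apply: DeriveDef.
  by rewrite /derivable HE; apply/cvg_ex; eexists; exact: H.
by rewrite /derive HE; exact: cvg_lim H.
Qed.

End UnderIntegral.

(** * Integrals of derivatives of compactly supported functions *)

Section CompactSupport.
Context {R : realType}.
Local Notation R2 := (R * R)%type.

Lemma integral_derivative_compact_support (F f : R -> R) (M : R) : 0 < M ->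
  (forall x : R, is_derive x 1 F (f x)) -> continuous f ->
  (forall x, M <= `|x| -> F x = 0) -> (forall x, M <= `|x| -> f x = 0) ->
  (\int[lebesgue_measure]_x (f x)%:E = 0)%E.
Proof.
move=> M0 dF cf F0 f0.
have cF : continuous F.
  by move=> x; apply/differentiable_continuous/derivable1_diffP; have [] := dF x.
have NM : - M < M by rewrite gtrN.
have -> : (\int[lebesgue_measure]_x (f x)%:E =
    \int[lebesgue_measure]_(x in `[(- M)%R, M]) (f x)%:E)%E.
  rewrite [RHS]integral_mkcond; apply: eq_integral => x _.
  rewrite patchE; case: ifPn => // /negP xM; rewrite f0// leNgt.
  by apply/negP => /ltW; rewrite ler_norml => xM'; apply: xM; rewrite inE/= in_itv.
rewrite (@continuous_FTC2 _ f F)//.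
- by rewrite !F0 ?normrN ?(gtr0_norm M0)// subee.
- exact: continuous_subspaceT.
- split.
  + by move=> x _; have [] := dF x.
  + exact/cvg_at_right_filter/cF.
  + exact/cvg_at_left_filter/cF.
- by move=> x _; rewrite derive1E; have [_] := dF x.
Qed.

(** Divergence theorem without boundary term: [T], cut off outside of [K], is of
class C^1 on the whole plane, because [U] and the complement of [K] cover it. By
Fubini's theorem the integration can start along the [i]-th axis, where it gives
the difference of two values of [T] outside of its support. *)
Lemma Rintegral_pd_compact_support (U K : set R2) (T : R2 -> R) (i : 'I_2) :
  open U -> compact K -> K `<=` U -> Ck_on 1 U T ->
  (forall p, U p -> ~ K p -> T p = 0) -> Rintegral mu2 K (pd i T) = 0.
Proof.
move=> oU cK KU cT T0.
pose S : R2 -> R := T \_ K.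
have SK p : ~ K p -> S p = 0.
  by move=> Kp; rewrite /S patchE; case: ifPn => // /[!inE].
have SU p : U p -> T p = S p.
  by move=> Up; rewrite /S patchE; case: ifPn => // /negP; rewrite inE; exact: T0.
have oCK : open (~` K) by apply: closed_openC; exact: compact_closed2.
have cSU : Ck_on 1 U S by exact: Ck_on_eq cT.
have cSK : Ck_on 1 (~` K) S.
  by apply: (Ck_on_eq oCK _ (Ck_on_cst 1 (~` K) (0 : R))) => p /SK ->.
have dS p : differentiable S p.
  by have [Kp|Kp] := pselect (K p); [exact/cSU.1/KU|exact: cSK.1].
have cD : continuous (pd i S).
  move=> p; have [Kp|Kp] := pselect (K p); last exact: (cSK.2 _ p Kp).
  exact: (cSU.2 _ p (KU _ Kp)).
have DK p : ~ K p -> pd i S p = 0.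
  move=> Kp; rewrite /pd -(@derive_cst _ _ _ (0 : R) p (dir i)).
  by apply: near_eq_derive; apply: (open_near_eq oCK) Kp => q /SK.
have -> : Rintegral mu2 K (pd i T) = Rintegral mu2 setT (pd i S).
  rewrite Rintegral_mkcond; apply: eq_Rintegral => p _.
  rewrite patchE; case: ifPn => [/[!inE] Kp|/negP]; last by rewrite inE => /DK.
  by apply: near_eq_derive; apply: (open_near_eq oU) (KU _ Kp).
have iD : mu2.-integrable setT (EFin \o pd i S).
  have := @continuous_compact_integrable2 _ K (pd i S) cK
    (continuous_subspaceT cD).
  move=> /(integrable_mkcond _ (compact_measurable2 cK)).1.
  congr (integrable _ _ _); apply/funext => p; rewrite patchE.
  by case: ifPn => // /negP; rewrite inE => /DK /= ->.
have [M M0 KM] := compact_sub_square cK.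
have offK x y : M <= `|x| \/ M <= `|y| -> ~ K (x, y).
  move=> xy /KM[/=]; rewrite !in_itv/= -!ltr_norml !ltNge.
  by case: xy => ->.
have H21 := integral21_prod_meas1 iD; have H12 := integral12_prod_meas1 iD.
rewrite /Rintegral (_ : integral _ _ _ = 0%E)//.
have [iE|iE] : i = 0 \/ i = 1.
  by case: i {cD DK iD H21 H12} => -[|[|//]] ?; [left|right]; apply/val_inj.
- apply: (etrans (esym H21)); apply: integral0_eq => y _.
  apply: (@integral_derivative_compact_support (fun x => S (x, y)) _ M) => //.
  + move=> x; apply: DeriveDef.
      exact/diff_derivable/differentiable_slice1/dS.
    by rewrite derive_slice1 /= iE.
  + move=> x; have := cD (x, y).
    apply: (@continuous_comp _ _ _ (fun x => (x, y)) (pd i S)).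
    by apply/differentiable_continuous/differentiable_pair.
  + by move=> x Mx; apply/SK/offK; left.
  + by move=> x Mx; apply/DK/offK; left.
- apply: (etrans (esym H12)); apply: integral0_eq => x _.
  apply: (@integral_derivative_compact_support (fun y => S (x, y)) _ M) => //.
  + move=> y; apply: DeriveDef.
      exact/diff_derivable/differentiable_slice2/dS.
    by rewrite derive_slice2 /= iE.
  + by move=> y; apply: continuous_slice2; exact: cD.
  + by move=> y My; apply/SK/offK; right.
  + by move=> y My; apply/DK/offK; right.
Qed.

End CompactSupport.

(** * Flux of a divergence-free field *)

Section TripleProduct.
Context {R : comRingType}.
Implicit Types (n p q s v w : R * R * R).

(** The determinant of the rows [n], [v], [w]. *)
Definition triple n v w : R :=
  n.1.1 * (v.1.2 * w.2 - v.2 * w.1.2) + n.1.2 * (v.2 * w.1.1 - v.1.1 * w.2) +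
  n.2 * (v.1.1 * w.1.2 - v.1.2 * w.1.1).

(** What the product rule gives for [exp z * triple n v w], with [exp z = e], when
the base point has velocity [s] and the vectors [v] and [w] have the velocities
[sv] and [sw]; [p] and [q] are the partial derivatives of [n] along the first
two axes, the field [n] being independent of the height [z]. *)
Definition triple_rate (e : R) n p q s v w sv sw : R :=
  e * (s.2 * triple n v w +
       triple (s.1.1 * p.1.1 + s.1.2 * q.1.1, s.1.1 * p.1.2 + s.1.2 * q.1.2,
               s.1.1 * p.2 + s.1.2 * q.2) v w +
       triple n sv w + triple n v sw).

(** The formula for the exterior derivative of the 2-form [exp z * triple n]: the
contributions of [sa], [sb] and [ab] cancel, and what remains of the difference
of the two sides is the determinant of [s], [a], [b] times [e] times
[p.1.1 + q.1.2 + n.2], the divergence of [exp z * n] at a point where [exp z = e]. *)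
Lemma triple_rateD (e : R) n p q s a b sa sb ab : p.1.1 + q.1.2 + n.2 = 0 ->
  triple_rate e n p q s a b sa sb =
  triple_rate e n p q a s b sa ab + triple_rate e n p q b a s ab sb.
Proof.
case: n p q s a b sa sb ab => -[n0 n1] n2 [[p0 p1] p2] [[q0 q1] q2] [[s0 s1] s2].
move=> [[a0 a1] a2] [[b0 b1] b2] [[? ?] ?] [[? ?] ?] [[? ?] ?] /= div0.
have -> : n2 = - p0 - q1.
  by apply/eqP; rewrite -subr_eq0 -div0; apply/eqP; ring.
by rewrite /triple_rate /triple /=; ring.
Qed.

End TripleProduct.

Section Flux.
Context {R : realType} {V : normedModType R}.
Variables (f0 f1 f2 : V -> R) (n0 n1 n2 : R * R -> R).

(** The pull-back by [f = (f0, f1, f2)] of the 2-form of the flux of the field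
[exp z * n (x, y)], evaluated on [v] and [w]: [exp z] times the determinant of
[n], ['D_v f] and ['D_w f]. It is written with operations on functions, to which
the rules of differentiation apply directly. *)
Definition flux (v w : V) : V -> R :=
  (expR \o f2) *
  ((fun x => n0 (f0 x, f1 x)) * ('D_v f1 * 'D_w f2 - 'D_v f2 * 'D_w f1) +
   (fun x => n1 (f0 x, f1 x)) * ('D_v f2 * 'D_w f0 - 'D_v f0 * 'D_w f2) +
   (fun x => n2 (f0 x, f1 x)) * ('D_v f0 * 'D_w f1 - 'D_v f1 * 'D_w f0)).

(** Premises in this form let all six derivatives be replaced at once. *)
Lemma flux_eq v w x (a b c a' b' c' : R) :
  'D_v f0 x = a -> 'D_v f1 x = b -> 'D_v f2 x = c ->
  'D_w f0 x = a' -> 'D_w f1 x = b' -> 'D_w f2 x = c' ->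
  flux v w x = expR (f2 x) * (n0 (f0 x, f1 x) * (b * c' - c * b') +
    n1 (f0 x, f1 x) * (c * a' - a * c') + n2 (f0 x, f1 x) * (a * b' - b * a')).
Proof. by move=> <- <- <- <- <- <-. Qed.

Lemma smooth_on_flux (U : set V) (O : set (R * R)) v w : open U ->
  (forall x, U x -> O (f0 x, f1 x)) ->
  smooth_on U f0 -> smooth_on U f1 -> smooth_on U f2 ->
  smooth_on O n0 -> smooth_on O n1 -> smooth_on O n2 ->
  smooth_on U (flux v w).
Proof.
move=> oU UO sf0 sf1 sf2 sn0 sn1 sn2.
have sn (n : R * R -> R) : smooth_on O n -> smooth_on U (fun x => n (f0 x, f1 x)).
  by move=> sn; exact: smooth_on_comp2 oU UO sf0 sf1 sn.
apply: smooth_onM => //; first exact: smooth_on_expR.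
have sD (a b c d : V -> R) : smooth_on U a -> smooth_on U b -> smooth_on U c ->
    smooth_on U d -> smooth_on U ('D_v a * 'D_w b - 'D_v c * 'D_w d).
  move=> sa sb sc sd.
  apply: smooth_onB => //; apply: smooth_onM => //; exact: smooth_on_derive.
apply: smooth_onD => //; last by apply: smooth_onM (sn _ sn2) _ => //; exact: sD.
apply: smooth_onD => //; last by apply: smooth_onM (sn _ sn1) _ => //; exact: sD.
by apply: smooth_onM (sn _ sn0) _ => //; exact: sD.
Qed.

Definition jet1 (v x : V) : R * R * R := ('D_v f0 x, 'D_v f1 x, 'D_v f2 x).
Definition jet2 (v w x : V) : R * R * R :=
  ('D_v ('D_w f0) x, 'D_v ('D_w f1) x, 'D_v ('D_w f2) x).

(** The pulled-back 2-form is closed, since the field has no divergence; written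
on the three directions, closedness says that the derivative of the flux in the
direction [s] is a divergence in the directions [a] and [b]. *)
Lemma derive_flux (U : set V) (O : set (R * R)) (s a b x : V) : open U ->
  (forall x, U x -> O (f0 x, f1 x)) ->
  smooth_on U f0 -> smooth_on U f1 -> smooth_on U f2 ->
  smooth_on O n0 -> smooth_on O n1 -> smooth_on O n2 ->
  (forall p, O p -> pd 0 n0 p + pd 1 n1 p + n2 p = 0) -> U x ->
  'D_s (flux a b) x = 'D_a (flux s b) x + 'D_b (flux a s) x.
Proof.
move=> oU UO sf0 sf1 sf2 sn0 sn1 sn2 divn Ux.
have dfg (f : V -> R) v w : smooth_on U f ->
    is_derive x w ('D_v f) ('D_w ('D_v f) x).
  by move=> sf; apply: smooth_on_is_derive Ux; exact: smooth_on_derive.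
have de v : is_derive x v (expR \o f2) (expR (f2 x) * 'D_v f2 x).
  exact: (is_derive_comp1 (is_derive_expR _)
    (smooth_on_differentiable sf2 Ux) (smooth_on_is_derive v sf2 Ux)).
have dn (n : R * R -> R) v : smooth_on O n -> is_derive x v (fun x => n (f0 x, f1 x))
   ('D_v f0 x * pd 0 n (f0 x, f1 x) + 'D_v f1 x * pd 1 n (f0 x, f1 x)).
  move=> sn; apply: is_derive_comp2.
  - exact: smooth_on_differentiable sf0 Ux.
  - exact: smooth_on_differentiable sf1 Ux.
  - exact: smooth_on_differentiable sn (UO _ Ux).
pose y := (f0 x, f1 x).
have E z v w : 'D_z (flux v w) x = triple_rate (expR (f2 x))
    (n0 y, n1 y, n2 y) (pd 0 n0 y, pd 0 n1 y, pd 0 n2 y)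
    (pd 1 n0 y, pd 1 n1 y, pd 1 n2 y)
    (jet1 z x) (jet1 v x) (jet1 w x) (jet2 z v x) (jet2 z w x).
  have dB (g h k l : V -> R) (g' h' k' l' : R) : is_derive x z g g' ->
      is_derive x z h h' -> is_derive x z k k' -> is_derive x z l l' ->
      is_derive x z (g * h - k * l)
        ((g x *: h' + h x *: g') - (k x *: l' + l x *: k')).
    by move=> da db dc dd; apply: is_deriveB; exact: is_deriveM.
  have d12 := dB _ _ _ _ _ _ _ _ (dfg _ v z sf1) (dfg _ w z sf2)
                 (dfg _ v z sf2) (dfg _ w z sf1).
  have d20 := dB _ _ _ _ _ _ _ _ (dfg _ v z sf2) (dfg _ w z sf0)
                 (dfg _ v z sf0) (dfg _ w z sf2).
  have d01 := dB _ _ _ _ _ _ _ _ (dfg _ v z sf0) (dfg _ w z sf1)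
                 (dfg _ v z sf1) (dfg _ w z sf0).
  have dF := is_deriveM (de z) (is_deriveD (is_deriveD
    (is_deriveM (dn _ z sn0) d12) (is_deriveM (dn _ z sn1) d20))
    (is_deriveM (dn _ z sn2) d01)).
  apply: (etrans (@derive_val _ _ _ _ _ _ _ dF)).
  rewrite /GRing.scale/= !fctE/=.
  rewrite /triple_rate /triple /jet1 /jet2 /= -/y.
  move: (expR _) (n0 _) (n1 _) (n2 _) (pd 0 n0 _) (pd 0 n1 _) (pd 0 n2 _)
    (pd 1 n0 _) (pd 1 n1 _) (pd 1 n2 _) => *.
  move: ('D_z ('D_v f0) x) ('D_z ('D_v f1) x) ('D_z ('D_v f2) x) ('D_z ('D_w f0) x) ('D_z ('D_w f1) x) ('D_z ('D_w f2) x) => *.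
  move: ('D_v f0 x) ('D_v f1 x) ('D_v f2 x) ('D_w f0 x) ('D_w f1 x) ('D_w f2 x) ('D_z f0 x) ('D_z f1 x) ('D_z f2 x) => *.
  ring.
have jet2C v w : jet2 v w x = jet2 w v x.
  have comm (f : V -> R) : smooth_on U f -> 'D_v ('D_w f) x = 'D_w ('D_v f) x.
    by move=> sf; exact: derive_comm oU (sf 2%N) Ux.
  by rewrite /jet2 (comm f0 sf0) (comm f1 sf1) (comm f2 sf2).
rewrite (E s a b) (E a s b) (E b a s).
rewrite (jet2C a s) (jet2C b s) (jet2C b a).
by apply: triple_rateD; exact: divn (UO _ Ux).
Qed.

End Flux.

(** * Euclidean and conformal geometry of parametrized surfaces *)

Section Geometry.
Context {R : realType}.
Local Notation R2 := (R * R)%type.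
Local Notation E3 := 'rV[R]_3.

Lemma sum2E (f : 'I_2 -> R) : \sum_(i < 2) f i = f 0 + f 1.
Proof.
by rewrite !big_ord_recl big_ord0 addr0; congr (_ + f _); exact/val_inj.
Qed.

Lemma sum3E (f : 'I_3 -> R) : \sum_(i < 3) f i = f 0 + f 1 + f 2.
Proof.
rewrite !big_ord_recl big_ord0 addr0 addrA.
by congr (_ + f _ + f _); exact/val_inj.
Qed.

Lemma dotE (v w : E3) :
  dot v w = v 0 0 * w 0 0 + v 0 1 * w 0 1 + v 0 2 * w 0 2.
Proof. by rewrite /dot mxE sum3E !mxE. Qed.

Lemma dotC (v w : E3) : dot v w = dot w v.
Proof. by rewrite !dotE; ring. Qed.

Lemma vec3E (a b c : R) :
  (vec3 a b c 0 0 = a) * (vec3 a b c 0 1 = b) * (vec3 a b c 0 2 = c).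
Proof. by rewrite /vec3 !mxE. Qed.

Lemma dot_vec3 (a b c a' b' c' : R) :
  dot (vec3 a b c) (vec3 a' b' c') = a * a' + b * b' + c * c'.
Proof. by rewrite dotE !vec3E. Qed.

Lemma dot_eq (v w : E3) (a b c a' b' c' : R) : v = vec3 a b c ->
  w = vec3 a' b' c' -> dot v w = a * a' + b * b' + c * c'.
Proof. by move=> -> ->; exact: dot_vec3. Qed.

Lemma cross_vec3 (a b c a' b' c' : R) :
  cross (vec3 a b c) (vec3 a' b' c') =
  vec3 (b * c' - c * b') (c * a' - a * c') (a * b' - b * a').
Proof. by rewrite /cross !vec3E. Qed.

Lemma dot_vec3r (v : E3) (a b c : R) :
  dot v (vec3 a b c) = v 0 0 * a + v 0 1 * b + v 0 2 * c.
Proof. by rewrite dotE !vec3E. Qed.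

Lemma dot_cross_eq (v w : E3) (a b c a' b' c' : R) :
  v 0 0 = a -> v 0 1 = b -> v 0 2 = c ->
  w 0 0 = a' -> w 0 1 = b' -> w 0 2 = c' ->
  dot (cross v w) (cross v w) =
  (b * c' - c * b') * (b * c' - c * b') + (c * a' - a * c') * (c * a' - a * c') +
  (a * b' - b * a') * (a * b' - b * a').
Proof. by move=> <- <- <- <- <- <-; exact: dot_vec3. Qed.

Lemma det2E (A : 'M[R]_2) : \det A = A 0 0 * A 1 1 - A 0 1 * A 1 0.
Proof.
rewrite (expand_det_row _ 0) sum2E /cofactor !det_mx11 !mxE /=.
rewrite expr0 mul1r expr1 mulN1r mulrN.
by congr (_ * A _ _ - _ * A _ _); exact/val_inj.
Qed.

Lemma inner_conformalE (q v w : E3) :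
  inner conformal_metric q v w = expR (x3 q) * dot v w.
Proof. by rewrite /inner /conformal_metric mul_mx_scalar -scalemxAl mxE. Qed.

Lemma inner_euclideanE (q v w : E3) : inner euclidean q v w = dot v w.
Proof. by rewrite /inner /euclidean mulmx1. Qed.

Lemma dot_crossE (v w : E3) :
  dot (cross v w) (cross v w) = dot v v * dot w w - dot v w * dot w v.
Proof. by rewrite !dotE /cross !vec3E; ring. Qed.

Lemma induced_conformalE (X : R2 -> E3) (p : R2) i j :
  Defs.induced conformal_metric X p i j =
  expR (x3 (X p)) * dot (pd i X p) (pd j X p).
Proof. by rewrite /Defs.induced mxE; exact: inner_conformalE. Qed.

(** The conformal factor [expR x3] on lengths squared multiplies areas by itself. *)
Lemma area_density_conformalE (X : R2 -> E3) (p : R2) :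
  let n := cross (pd 0 X p) (pd 1 X p) in
  area_density conformal_metric X p = expR (x3 (X p)) * Num.sqrt (dot n n).
Proof.
rewrite /= /area_density det2E !induced_conformalE dot_crossE.
set e := expR _.
have -> : forall a b c d : R,
    e * a * (e * b) - e * c * (e * d) = e ^+ 2 * (a * b - c * d).
  by move=> *; ring.
by rewrite sqrtrM ?sqr_ge0// sqrtr_sqr gtr0_norm// expR_gt0.
Qed.

Lemma Ck_on_coord {V : normedModType R} k (U : set V) (f : V -> E3) (j : 'I_3) :
  open U -> Ck_on k U f -> Ck_on k U (fun x => f x 0 j).
Proof.
move=> oU; elim: k f => [|k IH] f.
  move=> cf x Ux; apply: (@continuous_comp _ _ _ f (fun M : E3 => M 0 j)).
    exact: cf.
  exact: coord_continuous.
move=> [df cDf]; split=> [x Ux|v].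
  apply: (@differentiable_comp _ _ _ _ f (fun M : E3 => M 0 j)).
    exact: df.
  exact: differentiable_coord.
apply: (Ck_on_eq oU _ (IH _ (cDf v))) => x Ux.
by rewrite derive_mx ?mxE//; exact/diff_derivable/df.
Qed.

Lemma pd_coord (X : R2 -> E3) (p : R2) (i : 'I_2) (j : 'I_3) :
  derivable X p (dir i) -> pd i X p 0 j = pd i (fun q => X q 0 j) p.
Proof. by move=> dX; rewrite /pd derive_mx ?mxE. Qed.

End Geometry.

(** * The unit normal of a graph *)

Section Graph.
Context {R : realType}.
Local Notation R2 := (R * R)%type.
Local Notation E3 := 'rV[R]_3.
Variables (Omega : set R2) (u : R2 -> R).
Hypotheses (oOmega : open Omega) (su : smooth_on Omega u).
Local Notation X := (graph_chart u).

Lemma is_derive_fst (p v : R2) : is_derive p v (fst : R2 -> R) v.1.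
Proof.
have cfst : continuous (fst : R2 -> R) by move=> q; exact: cvg_fst.
apply: DeriveDef; last by rewrite deriveE ?diff_lin//; exact: linear_differentiable.
by apply: diff_derivable; exact: linear_differentiable.
Qed.

Lemma is_derive_snd (p v : R2) : is_derive p v (snd : R2 -> R) v.2.
Proof.
have csnd : continuous (snd : R2 -> R) by move=> q; exact: cvg_snd.
apply: DeriveDef; last by rewrite deriveE ?diff_lin//; exact: linear_differentiable.
by apply: diff_derivable; exact: linear_differentiable.
Qed.

Lemma is_derive_graph (p v : R2) : Omega p ->
  is_derive p v X (vec3 v.1 v.2 ('D_v u p)).
Proof.
move=> Op.
have H (j : 'I_3) : is_derive p v (fun q => X q 0 j) (vec3 v.1 v.2 ('D_v u p) 0 j).
  case: j => -[|[|[|//]]] j3.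
  - have -> : (fun q => X q 0 (Ordinal j3)) = fst.
      by apply/funext => q; rewrite !mxE.
    by rewrite !mxE; exact: is_derive_fst.
  - have -> : (fun q => X q 0 (Ordinal j3)) = snd.
      by apply/funext => q; rewrite !mxE.
    by rewrite !mxE; exact: is_derive_snd.
  - have -> : (fun q => X q 0 (Ordinal j3)) = u.
      by apply/funext => q; rewrite !mxE.
    by rewrite !mxE; exact: smooth_on_is_derive su Op.
have dX : derivable X p v.
  by apply/derivable_mxP => i j; rewrite ord1; have [] := H j.
apply: DeriveDef => //; rewrite derive_mx//; apply/rowP => j.
by rewrite mxE; have [_] := H j.
Qed.

Lemma pd0_graph p : Omega p -> pd 0 X p = vec3 1 0 (pd 0 u p).
Proof. by move=> Op; have [_] := is_derive_graph (dir 0) Op. Qed.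

Lemma pd1_graph p : Omega p -> pd 1 X p = vec3 0 1 (pd 1 u p).
Proof. by move=> Op; have [_] := is_derive_graph (dir 1) Op. Qed.

Lemma cross_graph p : Omega p ->
  cross (pd 0 X p) (pd 1 X p) = vec3 (- pd 0 u p) (- pd 1 u p) 1.
Proof.
move=> Op; rewrite (pd0_graph Op) (pd1_graph Op) cross_vec3.
by rewrite !(mul0r, mul1r, mulr0, mulr1, sub0r, subr0).
Qed.

(** The area element of the graph for the Euclidean metric. *)
Definition graph_area (p : R2) : R :=
  Num.sqrt (1 + pd 0 u p * pd 0 u p + pd 1 u p * pd 1 u p).

Lemma graph_area_arg_gt0 (a b : R) : 0 < 1 + a * a + b * b.
Proof. by rewrite -!expr2 -addrA ltr_pwDl// addr_ge0// sqr_ge0. Qed.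

Lemma graph_area_gt0 p : 0 < graph_area p.
Proof. by rewrite sqrtr_gt0 graph_area_arg_gt0. Qed.

Lemma graph_area_sq p : graph_area p * graph_area p =
  1 + pd 0 u p * pd 0 u p + pd 1 u p * pd 1 u p.
Proof. by rewrite -expr2 sqr_sqrtr// ltW// graph_area_arg_gt0. Qed.

Lemma unit_normal_graph p : Omega p -> unit_normal X p =
  (graph_area p)^-1 *: vec3 (- pd 0 u p) (- pd 1 u p) 1.
Proof.
move=> Op; rewrite /unit_normal (cross_graph Op) /graph_area dot_vec3.
have -> : 1 + pd 0 u p * pd 0 u p + pd 1 u p * pd 1 u p =
  - pd 0 u p * - pd 0 u p + - pd 1 u p * - pd 1 u p + 1 * 1 by ring.
by [].
Qed.

Definition normal (j : 'I_3) (p : R2) : R := unit_normal X p 0 j.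

Lemma normal_graph p : Omega p ->
  [/\ normal 0 p = - pd 0 u p * (graph_area p)^-1,
      normal 1 p = - pd 1 u p * (graph_area p)^-1 &
      normal 2 p = (graph_area p)^-1].
Proof.
move=> Op; rewrite /normal (unit_normal_graph Op).
by split; rewrite mxE vec3E mulrC ?mul1r.
Qed.

Lemma smooth_on_normal (j : 'I_3) : smooth_on Omega (normal j).
Proof.
have sp i : smooth_on Omega (pd i u) by exact: smooth_on_derive.
have sA : smooth_on Omega (fun p => (graph_area p)^-1).
  apply: smooth_on_inv => //; first by move=> p _; rewrite gt_eqF ?graph_area_gt0.
  apply: smooth_on_sqrt => //; first by move=> p _; exact: graph_area_arg_gt0.
  apply: smooth_onD (smooth_onM oOmega (sp 1) (sp 1)) => //.
  apply: smooth_onD (smooth_onM oOmega (sp 0) (sp 0)) => //.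
  exact: smooth_on_cst.
case: j => -[|[|[|//]]] j3.
- apply: (smooth_on_eq oOmega _ (smooth_onM oOmega (smooth_onN oOmega (sp 0)) sA)).
  move=> p Op; have [nE _ _] := normal_graph Op; apply: etrans (esym nE) _.
  by congr (unit_normal X p 0 _); exact/val_inj.
- apply: (smooth_on_eq oOmega _ (smooth_onM oOmega (smooth_onN oOmega (sp 1)) sA)).
  move=> p Op; have [_ nE _] := normal_graph Op; apply: etrans (esym nE) _.
  by congr (unit_normal X p 0 _); exact/val_inj.
- apply: (smooth_on_eq oOmega _ sA) => p Op; have [_ _ nE] := normal_graph Op.
  apply: etrans (esym nE) _.
  by congr (unit_normal X p 0 _); exact/val_inj.
Qed.

Lemma normal_unit p : Omega p ->
  normal 0 p * normal 0 p + normal 1 p * normal 1 p + normal 2 p * normal 2 p = 1.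
Proof.
move=> Op; have [-> -> ->] := normal_graph Op.
have A2 := graph_area_sq p.
have A0 : graph_area p != 0 by rewrite gt_eqF// graph_area_gt0.
have AV : graph_area p * (graph_area p)^-1 = 1 by rewrite mulfV.
move: (graph_area p) (graph_area p)^-1 A2 AV => a b A2 ab.
have -> : forall u1 u2, - u1 * b * (- u1 * b) + - u2 * b * (- u2 * b) + b * b =
    (1 + u1 * u1 + u2 * u2) * b * b by move=> *; ring.
by rewrite -A2 -mulrA mulrACA ab mulr1.
Qed.

(** The normal is orthogonal to its own derivatives, which determines the
vertical component of the latter by the horizontal ones. *)
Lemma pd_normal2 i p : Omega p ->
  pd i (normal 2) p = pd 0 u p * pd i (normal 0) p + pd 1 u p * pd i (normal 1) p.
Proof.
move=> Op.
have d j := smooth_on_is_derive (dir i) (smooth_on_normal j) Op.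
have dE := is_deriveD (is_deriveD (is_deriveM (d 0) (d 0)) (is_deriveM (d 1) (d 1)))
  (is_deriveM (d 2) (d 2)).
have : pd i (normal 0 * normal 0 + normal 1 * normal 1 + normal 2 * normal 2) p = 0.
  rewrite -(@derive_cst _ _ _ (1 : R) p (dir i)).
  apply: near_eq_derive; apply: (open_near_eq oOmega) Op => q Oq.
  by rewrite !fctE; exact: normal_unit.
rewrite [pd i _ p](@derive_val _ _ _ _ _ _ _ dE) /GRing.scale/=.
have A0 := graph_area_gt0 p; have [-> -> ->] := normal_graph Op.
rewrite -!/(pd i _ p).
move: (pd i (normal 0) p) (pd i (normal 1) p) (pd i (normal 2) p) => a b c.
move: (pd 0 u p) (pd 1 u p) => u1 u2 H.
have AV0 : (graph_area p)^-1 != 0 by rewrite invr_eq0 gt_eqF.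
apply: (mulfI AV0); apply: (@mulfI _ 2%:R); first by rewrite pnatr_eq0.
apply/eqP; rewrite -subr_eq0 -[X in _ == X]H; apply/eqP; ring.
Qed.

(** The mean curvature is the divergence of the normal extended to be constant
along the vertical axis. If [M] consists of the horizontal components of the
derivatives of the normal and [g] is the first fundamental form, then
[dot (pd i N p) (pd j X p) = (M *m g) i j]; the contraction with [g^-1] thus
leaves the trace of [M]. *)
Lemma mean_curvature_graph p : Omega p ->
  mean_curvature X p = pd 0 (normal 0) p + pd 1 (normal 1) p.
Proof.
move=> Op; have [g gdef] : exists g, g = fff X p by exists (fff X p).
have gE i j : g i j = dot (pd i X p) (pd j X p).
  by rewrite gdef /fff /Defs.induced mxE; exact: inner_euclideanE.
pose M := \matrix_(i < 2, k < 2)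
  (if k == 0 then pd i (normal 0) p else pd i (normal 1) p).
have dN i : derivable (unit_normal X) p (dir i).
  apply/derivable_mxP => i0 j; rewrite ord1.
  exact/diff_derivable/(smooth_on_differentiable (smooth_on_normal j) Op).
have x0 := pd0_graph Op; have x1 := pd1_graph Op.
have [g00 g01 g10 g11] : [/\ g 0 0 = 1 + pd 0 u p * pd 0 u p,
    g 0 1 = pd 0 u p * pd 1 u p, g 1 0 = pd 1 u p * pd 0 u p &
    g 1 1 = 1 + pd 1 u p * pd 1 u p].
  rewrite (etrans (gE 0 0) (dot_eq x0 x0)) (etrans (gE 0 1) (dot_eq x0 x1)).
  rewrite (etrans (gE 1 0) (dot_eq x1 x0)) (etrans (gE 1 1) (dot_eq x1 x1)).
  by rewrite !(mul0r, mul1r, mulr0, mulr1, add0r, addr0).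
have NE i k : pd i (unit_normal X) p 0 k = pd i (normal k) p.
  exact: pd_coord (dN i).
have MgE i j : dot (pd i (unit_normal X) p) (pd j X p) = (M *m g) i j.
  have -> : (M *m g) i j =
      pd i (normal 0) p * g 0 j + pd i (normal 1) p * g 1 j.
    by rewrite mxE sum2E ![M _ _]mxE.
  have N2 := pd_normal2 i Op.
  have [->|->] : j = 0 \/ j = 1.
    by case: j => -[|[|//]] ?; [left|right]; exact/val_inj.
  + rewrite (etrans (congr1 _ x0) (dot_vec3r _ _ _ _)) !NE N2 g00 g10.
    move: (pd 0 u p) (pd 1 u p) (pd i (normal 0) p) (pd i (normal 1) p) => *.
    by ring.
  + rewrite (etrans (congr1 _ x1) (dot_vec3r _ _ _ _)) !NE N2 g01 g11.
    move: (pd 0 u p) (pd 1 u p) (pd i (normal 0) p) (pd i (normal 1) p) => *.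
    by ring.
have gu : g \in unitmx.
  rewrite unitmxE det2E g00 g01 g10 g11 unitfE.
  have := graph_area_arg_gt0 (pd 0 u p) (pd 1 u p).
  move: (pd 0 u p) (pd 1 u p) => a b ab; rewrite gt_eqF//.
  by move: ab; congr (0 < _); ring.
have gT : g^T = g by apply/matrixP => i j; rewrite mxE !gE; exact: dotC.
transitivity (\tr (M *m g *m (invmx g)^T)).
  rewrite /mean_curvature /surf_div /fff_inv -gdef /mxtrace; apply: eq_bigr => i _.
  rewrite mxE; apply: eq_bigr => j _; rewrite MgE mulrC; congr (_ * _).
  by rewrite mxE.
rewrite trmx_inv gT -mulmxA mulmxV// mulmx1 /mxtrace sum2E ![M _ _]mxE.
by [].
Qed.

(** The translator equation says that the field [exp z * N (x, y)] has no
divergence, its divergence being [exp z * (H + dot e3 N)]. *)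
Lemma translating_divergence p : translating Omega X -> Omega p ->
  pd 0 (normal 0) p + pd 1 (normal 1) p + normal 2 p = 0.
Proof.
move=> tX Op; rewrite -(mean_curvature_graph Op) -[RHS](tX p Op); congr (_ + _).
by rewrite dotC /e3 dot_vec3r !mulr0 mulr1 !add0r.
Qed.

End Graph.

(** * Second derivative at a minimum *)

Section Minimum.
Context {R : realType}.

(** If the second derivative were negative at the minimum, the first one would be
negative to the right of [0], and [A] would decrease there by the mean value
theorem. *)
Lemma derive2_min (A B : R -> R) (d : R) : 0 < d ->
  (forall s : R, `|s| < d -> is_derive s 1 A (B s)) -> derivable B 0 1 ->
  (forall s, `|s| < d -> A 0 <= A s) -> B 0 = 0 /\ 0 <= 'D_1 B 0.
Proof.
move=> d0 dA dB minA.
have d00 : `|0 : R| < d by rewrite normr0.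
have itvd s : s \in `]- d, d[%R -> `|s| < d by rewrite in_itv/= ltr_norml.
have B0 : B 0 = 0.
  have [_ <-] := dA 0 d00.
  suff [_ ->] : is_derive (0 : R) 1 A 0 by [].
  apply: (@derive1_at_min R A (- d) d 0).
  - by rewrite (le_trans (ltW _) (ltW d0))// oppr_lt0.
  - by move=> s /itvd sd; have [] := dA s sd.
  - by rewrite in_itv/= oppr_lt0 d0.
  - by move=> s /itvd; exact: minA.
split=> //; rewrite leNgt; apply/negP => D0.
have /cvgr_lt/(_ _ D0) := dB.
move=> [e /= e0 eP].
have Bneg h : 0 < h -> h < e -> B h < 0.
  move=> h0 he.
  have := eP h; rewrite /ball_/= sub0r normrN gtr0_norm// => /(_ he).
  rewrite gt_eqF// => /(_ isT).
  by rewrite B0 subr0 addr0 [h *: 1]mulr1 pmulr_rlt0// invr_gt0.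
pose s := Num.min d e / 2.
have m0 : 0 < Num.min d e by rewrite lt_min d0 e0.
have s0 : 0 < s by rewrite divr_gt0.
have sm : s < Num.min d e by rewrite ltr_pdivrMr// ltr_pMr// ltr1n.
have [sd se] : s < d /\ s < e by move: sm; rewrite lt_min => /andP[].
have [c] : exists2 c, c \in `]0, s[%R & A s - A 0 = B c * (s - 0).
  apply: (@MVT R A B 0 s s0).
    move=> t; rewrite in_itv/= => /andP[t0 ts]; apply: dA.
    by rewrite gtr0_norm// (lt_trans ts).
  apply: derivable_within_continuous => t; rewrite in_itv/= => /andP[t0 ts].
  by have [] := dA t; rewrite ?ger0_norm// (le_lt_trans ts).
rewrite in_itv/= => /andP[c0 cs] E.
have Bc : B c < 0 by apply: Bneg => //; exact: lt_trans se.
have := minA s; rewrite gtr0_norm// => /(_ sd); rewrite -subr_ge0 E subr0.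
by rewrite leNgt pmulr_llt0 ?Bc.
Qed.

End Minimum.

Section SliceRegularity.
Context {R : realType} {V1 V2 W : normedModType R}.

Lemma Ck_on_slice2 k (U : set (V1 * V2)) (U2 : set V2) (f : V1 * V2 -> W) x :
  (forall y, U2 y -> U (x, y)) -> Ck_on k U f ->
  Ck_on k U2 (fun y => f (x, y)).
Proof.
move=> UU; elim: k f => [|k IH] f.
  by move=> cf y Uy; apply: continuous_slice2; apply: cf; exact: UU.
move=> [df cDf]; split=> [y Uy|v].
  by apply: differentiable_slice2; apply: df; exact: UU.
have -> : 'D_v (fun y => f (x, y)) = (fun y => 'D_((0, v) : V1 * V2) f (x, y)).
  by apply/funext => y; exact: derive_slice2.
exact: IH (cDf _).
Qed.

End SliceRegularity.

(** * Calibration of the variations of a translating graph *)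

Section Variation.
Context {R : realType}.
Local Notation R2 := (R * R)%type.
Local Notation E3 := 'rV[R]_3.
Variables (Omega : set R2) (u : R2 -> R) (eps : R) (K : set R2) (F : R -> R2 -> E3).
Hypotheses (oOmega : open Omega) (su : smooth_on Omega u).
Hypothesis Fvar : normal_variation conformal_metric Omega (graph_chart u) eps K F.
Local Notation X := (graph_chart u).
Local Notation slab d := ([set s : R | `|s| < d] `*` Omega).

Let sF : smooth_on (slab eps) (fun q => F q.1 q.2).
Proof. by have [] := Fvar. Qed.

Lemma open_abs_lt (d : R) : open [set s : R | `|s| < d].
Proof.
rewrite (_ : [set s : R | `|s| < d] = `]- d, d[%classic); first exact: interval_open.
by apply/seteqP; split => s /=; rewrite in_itv/= ltr_norml.
Qed.

Lemma near_abs_lt (d s : R) : `|s| < d -> \forall t \near s, `|t| < d.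
Proof. by move=> sd; apply: open_nbhs_nbhs; split => //; exact: open_abs_lt. Qed.

Lemma open_slab d : open (slab d).
Proof.
rewrite openE => -[s p] [/= sd Op].
exists ([set s : R | `|s| < d], Omega) => //=.
by split; apply: open_nbhs_nbhs; split => //; exact: open_abs_lt.
Qed.

Definition coord (j : 'I_3) (q : R * R2) : R := F q.1 q.2 0 j.

Definition dt : R * R2 := (1, 0).
Definition dx (i : 'I_2) : R * R2 := (0, dir i).

Lemma smooth_on_coord j : smooth_on (slab eps) (coord j).
Proof.
by move=> k; apply: (@Ck_on_coord _ _ _ _ (fun q => F q.1 q.2)) => //; exact: open_slab.
Qed.

Lemma pd_variation s p i j : `|s| < eps -> Omega p ->
  pd i (F s) p 0 j = 'D_(dx i) (coord j) (s, p).
Proof.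
move=> se Op; rewrite pd_coord; last first.
  apply: diff_derivable.
  apply: (@differentiable_slice2 _ _ _ _ (fun q => F q.1 q.2) s p).
  by apply: smooth_on_differentiable sF _; split.
exact: (derive_slice2 (coord j)).
Qed.

(** The squared Euclidean area element of the surfaces [F s], as a function on
the parameter space. *)
Definition cross_sq : R * R2 -> R :=
  let c i j := 'D_(dx 0) (coord i) * 'D_(dx 1) (coord j) -
               'D_(dx 0) (coord j) * 'D_(dx 1) (coord i) in
  c 1 2 * c 1 2 + c 2 0 * c 2 0 + c 0 1 * c 0 1.

Lemma cross_sq_eq q (a b c a' b' c' : R) :
  'D_(dx 0) (coord 0) q = a -> 'D_(dx 0) (coord 1) q = b ->
  'D_(dx 0) (coord 2) q = c -> 'D_(dx 1) (coord 0) q = a' ->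
  'D_(dx 1) (coord 1) q = b' -> 'D_(dx 1) (coord 2) q = c' ->
  cross_sq q = (b * c' - c * b') * (b * c' - c * b') +
    (c * a' - a * c') * (c * a' - a * c') + (a * b' - b * a') * (a * b' - b * a').
Proof. by move=> <- <- <- <- <- <-. Qed.

Lemma cross_sqE s p : `|s| < eps -> Omega p ->
  cross_sq (s, p) = let n := cross (pd 0 (F s) p) (pd 1 (F s) p) in dot n n.
Proof.
move=> se Op /=.
have E i j := pd_variation i j se Op.
exact: esym (dot_cross_eq (E 0 0) (E 0 1) (E 0 2) (E 1 0) (E 1 1) (E 1 2)).
Qed.

Lemma smooth_on_cross_sq : smooth_on (slab eps) cross_sq.
Proof.
have oS : open (slab eps) by exact: open_slab.
have sD i j : smooth_on (slab eps) ('D_(dx i) (coord j)).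
  exact/smooth_on_derive/smooth_on_coord.
have sC i j : smooth_on (slab eps)
  ('D_(dx 0) (coord i) * 'D_(dx 1) (coord j) - 'D_(dx 0) (coord j) * 'D_(dx 1) (coord i)).
  apply: smooth_onB => //; apply: smooth_onM => //; exact: sD.
have sCC i j := smooth_onM oS (sC i j) (sC i j).
exact: (smooth_onD oS (smooth_onD oS (sCC 1 2) (sCC 2 0)) (sCC 0 1)).
Qed.

Definition density : R * R2 -> R :=
  (expR \o coord 2) * (fun q => Num.sqrt (cross_sq q)).

Lemma area_density_variation s p : `|s| < eps -> Omega p ->
  area_density conformal_metric (F s) p = density (s, p).
Proof.
move=> se Op; rewrite area_density_conformalE.
apply: (congr1 (fun c => expR (x3 (F s p)) * Num.sqrt c)).
exact: esym (cross_sqE se Op).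
Qed.

Lemma pd_fixed s p i : (\forall q \near p, F s q = X q) -> pd i (F s) p = pd i X p.
Proof. exact: near_eq_derive. Qed.

Lemma cross_sq_graph s p : `|s| < eps -> Omega p ->
  (\forall q \near p, F s q = X q) -> cross_sq (s, p) = graph_area u p * graph_area u p.
Proof.
move=> se Op FX; rewrite (cross_sqE se Op).
rewrite /= (pd_fixed 0 FX) (pd_fixed 1 FX) (cross_graph su Op) dot_vec3.
by rewrite graph_area_sq !mulrNN mulr1 addrC addrA.
Qed.

Lemma coord_graph s p j : F s p = X p -> coord j (s, p) = X p 0 j.
Proof. by rewrite /coord /= => ->. Qed.

(** For small [s] the surface [F s] lies above [Omega], where the calibrating field
lives, and is immersed, so that its area element is smooth. Both conditions are
open and hold at [s = 0]; above [K] compactness makes them hold for all small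
[s], and outside of [K] the surface does not move. *)
Lemma tube : exists d, [/\ 0 < d, d <= eps &
  forall q, slab d q -> Omega (coord 0 q, coord 1 q) /\ 0 < cross_sq q].
Proof.
have [eps0 [cK KO] _ [F0 FK] _] := Fvar.
pose good q := Omega (coord 0 q, coord 1 q) /\ 0 < cross_sq q.
have z0 : `|0 : R| < eps by rewrite normr0.
have good_fixed s p : `|s| < eps -> Omega p ->
    (\forall q \near p, F s q = X q) -> good (s, p).
  move=> se Op FX; split; last first.
    by rewrite (cross_sq_graph se Op FX) mulr_gt0// graph_area_gt0.
  rewrite !(coord_graph _ (nbhs_singleton FX)) /graph_chart !vec3E.
  by case: p Op {FX}.
have good_near p : K p -> \forall p' \near p & s \near (0 : R), good (s, p').
  move=> Kp; have Op := KO p Kp.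
  have [inO crossp] : good (0, p).
    apply: good_fixed => //; apply: filterS (open_nbhs_nbhs (conj oOmega Op)).
    by move=> q; exact: F0.
  have inS : slab eps (0, p) by split.
  have cc j : {for (0, p), continuous (coord j)}.
    exact: smooth_on_continuous (smooth_on_coord j) inS.
  have cC : {for (0, p), continuous cross_sq}.
    exact: smooth_on_continuous smooth_on_cross_sq inS.
  have : \forall q \near ((0 : R), p), good q.
    have nO : \forall q \near ((0 : R), p), Omega (coord 0 q, coord 1 q).
      apply: (cvg_pair (cc 0) (cc 1)).
      exact: open_nbhs_nbhs (conj oOmega inO).
    have nC : \forall q \near ((0 : R), p), 0 < cross_sq q.
      by have /cvgr_gt := cC; apply.
    by apply: filterS2 nO nC => q Oq Cq; exact: (conj Oq Cq).
  move=> [[A B] /= [nA nB] ABgood].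
  by exists (B, A) => //= -[p' s] [/= Bp As]; exact: (ABgood (s, p')).
have : \forall s \near (0 : R), K `<=` (fun p => good (s, p)).
  exact: ((compact_near_coveringP K).1 cK R (nbhs (0 : R))
    (fun s p => good (s, p)) _ good_near).
move=> /nbhs_ballP[e /= e0 eP].
exists (Num.min e eps); split; first by rewrite lt_min e0 eps0.
  by rewrite ge_min lexx orbT.
move=> [s p] [/=]; rewrite lt_min => /andP[se seps] Op.
have [Kp|Kp] := pselect (K p).
  by apply: (eP s) => //; rewrite /ball/= sub0r normrN.
apply: good_fixed => //.
have nK : \forall q \near p, (~` K) q.
  apply: open_nbhs_nbhs; split => //.
  by apply: closed_openC; exact: compact_closed2.
by apply: filterS2 nK (open_nbhs_nbhs (conj oOmega Op)) => q Kq Oq; exact: FK.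
Qed.

(** The flux density of the calibrating field [exp z * N (x, y)], [N] being the unit
normal of the graph. *)
Definition var_flux (v w : R * R2) : R * R2 -> R :=
  flux (coord 0) (coord 1) (coord 2) (normal u 0) (normal u 1) (normal u 2) v w.

Lemma unit_dot_le (n0 n1 n2 a b c : R) : n0 * n0 + n1 * n1 + n2 * n2 = 1 ->
  n0 * a + n1 * b + n2 * c <= Num.sqrt (a * a + b * b + c * c).
Proof.
move=> n1E; rewrite (le_trans (ler_norm _))// -sqrtr_sqr ler_wsqrtr//.
rewrite -[leRHS]mul1r -n1E -subr_ge0.
have -> : (n0 * n0 + n1 * n1 + n2 * n2) * (a * a + b * b + c * c) -
    (n0 * a + n1 * b + n2 * c) ^+ 2 =
  (n0 * b - n1 * a) ^+ 2 + (n1 * c - n2 * b) ^+ 2 + (n2 * a - n0 * c) ^+ 2 by ring.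
by rewrite !addr_ge0// sqr_ge0.
Qed.

(** Calibration inequality: the calibrating field has length [exp z], the factor
by which the conformal metric multiplies areas. *)
Lemma var_flux_le q : Omega (coord 0 q, coord 1 q) ->
  var_flux (dx 0) (dx 1) q <= density q.
Proof.
move=> Oq.
pose D i j := 'D_(dx i) (coord j) q.
have H := unit_dot_le (D 0 1 * D 1 2 - D 0 2 * D 1 1)
  (D 0 2 * D 1 0 - D 0 0 * D 1 2) (D 0 0 * D 1 1 - D 0 1 * D 1 0)
  (normal_unit su Oq).
rewrite /var_flux (flux_eq _ _ _ erefl erefl erefl erefl erefl erefl).
have -> : density q = expR (coord 2 q) * Num.sqrt (cross_sq q) by [].
rewrite (cross_sq_eq erefl erefl erefl erefl erefl erefl).
by rewrite ler_pM2l ?expR_gt0.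
Qed.

(** The graph is calibrated: the field is normal to it. *)
Lemma var_flux0 p : Omega p -> var_flux (dx 0) (dx 1) (0, p) = density (0, p).
Proof.
move=> Op; have [eps0 _ _ [F0 _] _] := Fvar.
have z0 : `|0 : R| < eps by rewrite normr0.
have FX : \forall q \near p, F 0 q = X q.
  by apply: filterS (open_nbhs_nbhs (conj oOmega Op)) => q; exact: F0.
have e i j : 'D_(dx i) (coord j) (0, p) = pd i X p 0 j.
  exact: etrans (esym (pd_variation i j z0 Op)) (congr1 (fun m : E3 => m 0 j) (pd_fixed i FX)).
have e0 j := etrans (e 0 j) (congr1 (fun m : E3 => m 0 j) (pd0_graph su Op)).
have e1 j := etrans (e 1 j) (congr1 (fun m : E3 => m 0 j) (pd1_graph su Op)).
have v0 (a b c : R) : vec3 a b c 0 0 = a by rewrite vec3E.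
have v1 (a b c : R) : vec3 a b c 0 1 = b by rewrite vec3E.
have v2 (a b c : R) : vec3 a b c 0 2 = c by rewrite vec3E.
rewrite /var_flux (flux_eq _ _ _ (etrans (e0 0) (v0 _ _ _))
  (etrans (e0 1) (v1 _ _ _)) (etrans (e0 2) (v2 _ _ _)) (etrans (e1 0) (v0 _ _ _))
  (etrans (e1 1) (v1 _ _ _)) (etrans (e1 2) (v2 _ _ _))).
apply: (congr1 (fun c => expR (coord 2 (0, p)) * c)).
have -> : (coord 0 (0, p), coord 1 (0, p)) = p.
  rewrite !(coord_graph _ (nbhs_singleton FX)) /graph_chart !vec3E.
  by case: (p).
rewrite (cross_sq_graph z0 Op FX) -expr2 sqrtr_sqr gtr0_norm ?graph_area_gt0//.
have [-> -> ->] := normal_graph su Op.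
have A0 : graph_area u p != 0 by rewrite gt_eqF ?graph_area_gt0.
have := graph_area_sq u p; have := mulVf A0.
move: (graph_area u p) (graph_area u p)^-1 (pd 0 u p) (pd 1 u p) => a b u1 u2 ba aE.
have -> : - u1 * b * (0 * u2 - u1 * 1) + - u2 * b * (u1 * 0 - 1 * u2) +
   b * (1 * 1 - 0 * 0) = b * (1 + u1 * u1 + u2 * u2) by ring.
by rewrite -aE mulrA ba mul1r.
Qed.

Lemma velocity_off s p j : `|s| < eps -> Omega p -> ~ K p ->
  'D_dt (coord j) (s, p) = 0.
Proof.
have [_ _ _ [_ FK] _] := Fvar.
move=> se Op Kp; rewrite -(derive_slice1 (coord j)).
rewrite -(@derive_cst _ _ _ (X p 0 j) s (1 : R)); apply: near_eq_derive.
apply: filterS (near_abs_lt se) => t te.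
by rewrite /coord /= FK.
Qed.

Section Tube.
Variable d : R.
Hypotheses (d0 : 0 < d) (de : d <= eps).
Hypothesis dtube : forall q, slab d q ->
  Omega (coord 0 q, coord 1 q) /\ 0 < cross_sq q.
Hypothesis tX : translating Omega X.

Let sub_slab : slab d `<=` slab eps.
Proof. by move=> [s p] [/= sd Op]; split => //=; exact: lt_le_trans de. Qed.

Let oS : open (slab d). Proof. exact: open_slab. Qed.

Let sc j : smooth_on (slab d) (coord j).
Proof. exact: smooth_on_subset sub_slab (smooth_on_coord j). Qed.

Let sn j : smooth_on Omega (normal u j).
Proof. exact: smooth_on_normal. Qed.

Let tubeO q : slab d q -> Omega (coord 0 q, coord 1 q).
Proof. by move=> /dtube[]. Qed.

Lemma smooth_on_var_flux v w : smooth_on (slab d) (var_flux v w).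
Proof. exact: smooth_on_flux oS tubeO (sc 0) (sc 1) (sc 2) (sn 0) (sn 1) (sn 2). Qed.

Lemma smooth_on_density : smooth_on (slab d) density.
Proof.
apply: smooth_onM => //; first exact: smooth_on_expR.
apply: smooth_on_sqrt => //; first by move=> q /dtube[].
exact: smooth_on_subset sub_slab smooth_on_cross_sq.
Qed.

(** The flux does not depend on [s]: its derivative is the integral of the
divergence of a field which contains the velocity of the variation as a factor
and is therefore supported in [K]. *)
Lemma Rintegral_derive_var_flux s : `|s| < d ->
  Rintegral mu2 K (fun p => 'D_dt (var_flux (dx 0) (dx 1)) (s, p)) = 0.
Proof.
move=> sd; have [_ [cK KO] _ _ _] := Fvar.
have se : `|s| < eps by exact: lt_le_trans de.
have inS p : Omega p -> slab d (s, p) by move=> Op; split.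
pose T0 p := var_flux dt (dx 1) (s, p); pose T1 p := var_flux (dx 0) dt (s, p).
have cT0 : Ck_on 1 Omega T0.
  exact: (Ck_on_slice2 inS (smooth_on_var_flux dt (dx 1) 1%N)).
have cT1 : Ck_on 1 Omega T1.
  exact: (Ck_on_slice2 inS (smooth_on_var_flux (dx 0) dt 1%N)).
have T0K p : Omega p -> ~ K p -> T0 p = 0.
  move=> Op Kp; have v j := velocity_off j se Op Kp.
  rewrite /T0 /var_flux (flux_eq _ _ _ (v 0) (v 1) (v 2) erefl erefl erefl).
  by rewrite !mul0r !subr0 !mulr0 !addr0 mulr0.
have T1K p : Omega p -> ~ K p -> T1 p = 0.
  move=> Op Kp; have v j := velocity_off j se Op Kp.
  rewrite /T1 /var_flux (flux_eq _ _ _ erefl erefl erefl (v 0) (v 1) (v 2)).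
  by rewrite !mulr0 !subr0 !mulr0 !addr0 mulr0.
have iT (T : R2 -> R) i : Ck_on 1 Omega T -> mu2.-integrable K (EFin \o pd i T).
  move=> cT; apply: continuous_compact_integrable2 => //.
  by apply: continuous_within => p /KO Op; exact: (cT.2 (dir i)).
transitivity (Rintegral mu2 K (fun p => pd 0 T0 p + pd 1 T1 p)).
  apply: eq_Rintegral => p; rewrite inE => Kp.
  apply: etrans (derive_flux dt (dx 0) (dx 1) oS tubeO (sc 0) (sc 1) (sc 2)
     (sn 0) (sn 1) (sn 2) _ (inS p (KO p Kp))) _.
    by move=> y Oy; exact: (translating_divergence oOmega su tX Oy).
  exact: esym (congr2 +%R (derive_slice2 (var_flux dt (dx 1)) s p (dir 0))
    (derive_slice2 (var_flux (dx 0) dt) s p (dir 1))).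
apply: etrans (RintegralD (compact_measurable2 cK) (iT _ 0 cT0) (iT _ 1 cT1)) _.
apply: etrans (congr2 +%R
  (Rintegral_pd_compact_support 0 oOmega cK KO cT0 T0K)
  (Rintegral_pd_compact_support 1 oOmega cK KO cT1 T1K)) _.
exact: addr0.
Qed.

Definition density_integral (s : R) : R := Rintegral mu2 K (fun p => density (s, p)).
Definition density_rate (s : R) : R :=
  Rintegral mu2 K (fun p => 'D_dt density (s, p)).
Definition flux_integral (s : R) : R :=
  Rintegral mu2 K (fun p => var_flux (dx 0) (dx 1) (s, p)).

Lemma is_derive_density_integral (s : R) : `|s| < d ->
  is_derive s 1 density_integral (density_rate s).
Proof.
move=> sd; have [_ [cK KO] _ _ _] := Fvar.
exact: (is_derive_under_integral oOmega cK KO (smooth_on_density 1%N) sd).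
Qed.

Lemma derivable_density_rate : derivable density_rate 0 1.
Proof.
have [_ [cK KO] _ _ _] := Fvar.
have z0 : `|0 : R| < d by rewrite normr0.
have sD := smooth_on_derive dt smooth_on_density.
by have [] := is_derive_under_integral oOmega cK KO (sD 1%N) z0.
Qed.

Lemma is_derive_flux_integral (s : R) : `|s| < d -> is_derive s 1 flux_integral 0.
Proof.
move=> sd; have [_ [cK KO] _ _ _] := Fvar.
rewrite -[X in is_derive _ _ _ X](Rintegral_derive_var_flux sd).
exact: (is_derive_under_integral oOmega cK KO (smooth_on_var_flux _ _ 1%N) sd).
Qed.

Lemma flux_integral_le (s : R) : `|s| < d -> flux_integral s <= density_integral s.
Proof.
move=> sd; have [_ [cK KO] _ _ _] := Fvar.
have iS phi : smooth_on (slab d) phi ->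
    mu2.-integrable K (EFin \o (fun p => phi (s, p))).
  move=> sphi; apply: continuous_compact_integrable2 => //.
  apply: continuous_within => p /KO Op; apply: continuous_slice2.
  by apply: smooth_on_continuous sphi _; split.
apply: le_Rintegral.
- exact: compact_measurable2.
- exact: iS (smooth_on_var_flux _ _).
- exact: iS smooth_on_density.
- by move=> p /KO Op; apply: var_flux_le; apply: tubeO; split.
Qed.

Lemma flux_integral0 : flux_integral 0 = density_integral 0.
Proof.
have [_ [cK KO] _ _ _] := Fvar.
apply: eq_Rintegral => p; rewrite inE => /KO Op; exact: var_flux0.
Qed.

(** The area minus the flux is nonnegative and vanishes at [s = 0], and it has the
same derivatives as the area. *)
Lemma density_integral_min : density_rate 0 = 0 /\ 0 <= 'D_1 density_rate 0.
Proof.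
apply: (@derive2_min R (density_integral - flux_integral) density_rate d d0).
- move=> s sd; rewrite -[density_rate s]subr0.
  exact: is_deriveB (is_derive_density_integral sd) (is_derive_flux_integral sd).
- exact: derivable_density_rate.
- move=> s sd; have := flux_integral_le sd; rewrite -subr_ge0.
  have E0 : density_integral 0 - flux_integral 0 = 0.
    by apply/eqP; rewrite subr_eq0; apply/eqP/esym/flux_integral0.
  rewrite -[X in X <= _ -> _]E0; exact.
Qed.

Lemma area_near_density (s : R) : `|s| < d ->
  \forall t \near s, density_integral t = area conformal_metric (F t) K.
Proof.
move=> sd; have [_ [cK KO] _ _ _] := Fvar.
apply: filterS (near_abs_lt sd) => t td.
apply: eq_Rintegral => p; rewrite inE => /KO Op; apply/esym.
by apply: area_density_variation => //; exact: lt_le_trans de.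
Qed.

Lemma stable_in_tube : let a s := area conformal_metric (F s) K in
  [/\ \forall s \near (0 : R), derivable a s 1,
      derivable a^`()%classic 0 1,
      a^`()%classic 0 = 0 &
      0 <= a^`(2)%classic 0].
Proof.
move=> a; have z0 : `|0 : R| < d by rewrite normr0.
have da (s : R) : `|s| < d -> is_derive s 1 a (density_rate s).
  move=> sd; apply: near_eq_is_derive (is_derive_density_integral sd).
  exact: area_near_density.
have near_d : \forall s \near (0 : R), `|s| < d.
  exact: near_abs_lt.
have rate_near : \forall s \near (0 : R), density_rate s = a^`()%classic s.
  by apply: filterS near_d => s sd; rewrite derive1E; have [_] := da s sd.
have [rate0 rate_ge0] := density_integral_min.
split.
- by apply: filterS near_d => s sd; have [] := da s sd.
- exact: near_eq_derivable rate_near derivable_density_rate.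
- by rewrite -(nbhs_singleton rate_near).
- by rewrite derive1nS derive1n1 derive1E -(near_eq_derive _ rate_near).
Qed.

End Tube.

End Variation.

Theorem proposition2p3 (R : realType) (Omega : set (R * R)) (u : R * R -> R)
    (hgraph : translating_graph Omega u)
    (hstable : L_stable Omega (graph_chart u)) :
  stable_minimal conformal_metric Omega (graph_chart u).
Proof.
have [[_ oOmega _] su tX] := hgraph.
move=> eps K F Fvar.
have [d [d0 de dtube]] := tube oOmega su Fvar.
exact: (stable_in_tube oOmega su Fvar d0 de dtube tX).
Qed.
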